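(* Let $(M^{2n},J)$ be a complex manifold and $(\omega,\beta)$ a solution of the pluriclosed flow $$\frac{\partial}{\partial t}\omega=-\rho_B^{1,1},\qquad \frac{\partial}{\partial t}\beta=-\rho_B^{2,0}.$$ Then the associated generalized metric $G$ on $T^{1,0}\oplus\Lambda^{1,0}$ satisfies $$\frac{\partial}{\partial t}G=-S,\qquad S_{A\bar B}=g^{\bar j i}\,\Omega_{i\bar jA\bar B},$$ where $\Omega$ is the Chern curvature of $G$.
   Context: **Metrics and flow.** A Hermitian metric $g$ on $(M,J)$ has components $g_{i\bar j}$ in local complex coordinates, inverse $g^{\bar l k}$, and Kähler form $\omega$; it is pluriclosed if $\sqrt{-1}\,\partial\bar\partial\omega=0$. The Bismut connection is the unique Hermitian connection with skew-symmetric torsion, $\nabla^B=D+\frac12 g^{-1}H$, $H=d^c\omega$, with $D$ the Levi-Civita connection; $\Omega^B$ is its curvature and $\rho_B=\mathrm{tr}\,\Omega^B\in\Lambda^2$ (a closed form representing $\pi c_1$), with $(p,q)$-parts $\rho_B^{p,q}$. Along the flow $\beta\in\Lambda^{2,0}$ is the torsion potential, i.e. $\bar\partial\beta=\partial\omega$. **Generalized metric.** Given a Hermitian metric $g$ and $\beta\in\Lambda^{2,0}$ with components $\beta_{ij}$ and conjugate components $\bar\beta_{\bar i\bar j}$, the generalized metric $G=G(g,\beta)$ is the Hermitian metric on the holomorphic bundle $T^{1,0}\oplus\Lambda^{1,0}$ given, with $Z^i=\partial/\partial z^i$, $W^i=dz^i$, by $$G_{Z^i\bar Z^j}=g_{i\bar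 j}+\beta_{ik}\bar\beta_{\bar j\bar l}g^{\bar l k},\quad G_{Z^i\bar W^j}=g^{\bar jp}\beta_{ip},\quad G_{W^i\bar Z^j}=g^{\bar p i}\bar\beta_{\bar j\bar p},\quad G_{W^i\bar W^j}=g^{\bar j i}.$$ **Curvature.** Capital indices $A,B,\dots$ run over the holomorphic frame $\{Z^i,W^i\}$. The Chern curvature of $G$ is, in coordinates, $\Omega_{i\bar jA\bar B}=-\partial_i\partial_{\bar j}G_{A\bar B}+\partial_iG_{A\bar C}\,G^{\bar CD}\,\partial_{\bar j}G_{D\bar B}$.
   Formalization: The torsion potential is taken with ∂̄β = −∂ω instead of ∂̄β = ∂ω: since dρ_B = 0 the stated flow preserves ∂ω + ∂̄β, and with the other sign the claim fails whenever ρ_B^{2,0} ≠ 0. Also, ρ_B = √-1 tr over T^{1,0} with ω = √-1 g_{i j̄} dz^i∧dz̄^j. *)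

(* Defs.v *)
From mathcomp Require Import all_boot all_order all_algebra.
From mathcomp Require Import complex.
From mathcomp Require Import all_classical all_reals all_analysis.

Set Implicit Arguments.
Unset Strict Implicit.
Unset Printing Implicit Defensive.

Import Order.TTheory GRing.Theory Num.Theory.
Import numFieldNormedType.Exports.

Local Open Scope classical_set_scope.
Local Open Scope ring_scope.
Local Open Scope complex_scope.

(* A point of C^n is a row vector (x_1..x_n, y_1..y_n) of real coordinates,
   with z^k = x_k + i y_k.  The complexified tangent space has the frame
   d/dz^1 .. d/dz^n, d/dzbar^1 .. d/dzbar^n, indexed by 'I_(n + n). *)

Notation cspace R n := 'rV[R]_(n + n).
Notation hol n i := (lshift n i).
Notation ahol n i := (rshift n i).

Definition is_hol {n} (A : 'I_(n + n)) : bool := (A < n)%N.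

Fixpoint Ck {R : realType} {V W : normedModType R} (k : nat) (U : set V)
    (f : V -> W) : Prop :=
  (forall x, U x -> {for x, continuous f}) /\
  if k is k'.+1 then
    forall v, (forall x, U x -> derivable f x v) /\ Ck k' U ('D_v f)
  else True.

Definition csmooth {R : realType} {n} (U : set (cspace R n))
    (f : cspace R n -> R[i]) : Prop :=
  forall k, Ck k U (fun p => complex.Re (f p)) /\
            Ck k U (fun p => complex.Im (f p)).

Definition zcoord {R : realType} {n} (k : 'I_n) (p : cspace R n) : R[i] :=
  p 0 (lshift n k) +i* p 0 (rshift n k).

Definition pderiv {R : realType} {n} (k : 'I_(n + n))
    (f : cspace R n -> R[i]) (p : cspace R n) : R[i] :=
  'D_(delta_mx 0 k) (fun q => complex.Re (f q)) p +i*
  'D_(delta_mx 0 k) (fun q => complex.Im (f q)) p.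

(* Wirtinger derivative of f along the frame vector of index A. *)
Definition wderiv {R : realType} {n} (A : 'I_(n + n))
    (f : cspace R n -> R[i]) (p : cspace R n) : R[i] :=
  match fintype.split A with
  | inl k => 2^-1 * (pderiv (lshift n k) f p - 'i * pderiv (rshift n k) f p)
  | inr k => 2^-1 * (pderiv (lshift n k) f p + 'i * pderiv (rshift n k) f p)
  end.

Definition holomorphic {R : realType} {n} (U : set (cspace R n))
    (f : cspace R n -> R[i]) : Prop :=
  csmooth U f /\ forall p, U p -> forall k, wderiv (ahol n k) f p = 0.

(* A k-form is given by its values alpha(d_A1, .., d_Ak) on the frame, so that
   alpha = 1/k! sum alpha_(A1 .. Ak) d^A1 /\ .. /\ d^Ak. *)

Definition form (R : realType) (n k : nat) :=
  k.-tuple 'I_(n + n) -> cspace R n -> R[i].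

Definition tdel {T : Type} {k} (I : k.+1.-tuple T) (j : 'I_k.+1) : k.-tuple T :=
  [tuple tnth I (lift j l) | l < k].

(* The exterior derivative is sum_j (-1)^j d_(A_j) alpha(.., no A_j, ..);
   keeping the holomorphic, resp. antiholomorphic, A_j gives its (1,0) part del
   and its (0,1) part delbar. *)
Definition del {R : realType} {n k} (alpha : form R n k) : form R n k.+1 :=
  fun I p => \sum_(j < k.+1 | is_hol (tnth I j))
               (-1) ^+ j * wderiv (tnth I j) (alpha (tdel I j)) p.

Definition delbar {R : realType} {n k} (alpha : form R n k) : form R n k.+1 :=
  fun I p => \sum_(j < k.+1 | ~~ is_hol (tnth I j))
               (-1) ^+ j * wderiv (tnth I j) (alpha (tdel I j)) p.

Definition form_part {R : realType} {n k} (p q : nat) (alpha : form R n k) :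
    form R n k :=
  fun I x => if (count is_hol I == p) && (count (predC is_hol) I == q)
             then alpha I x else 0.

(* The convention throughout is g_(i jbar) = g(d/dz^i, d/dzbar^j) and
   beta_(ij) = beta(d/dz^i, d/dz^j), i.e.
      omega = sqrt(-1) g_(i jbar) dz^i /\ dzbar^j,
      beta = 1/2 beta_(ij) dz^i /\ dz^j. *)

Definition mfun (R : realType) (n : nat) := cspace R n -> 'M[R[i]]_n.

Definition adj {R : realType} {m n} (A : 'M[R[i]]_(m, n)) : 'M[R[i]]_(n, m) :=
  \matrix_(i, j) (A j i)^*.

Definition herm_posdef {R : realType} {n} (A : 'M[R[i]]_n) : Prop :=
  adj A = A /\ forall v : 'rV[R[i]]_n, v != 0 -> 0 < (v *m A *m adj v) 0 0.

(* The complex bilinear extension of the Riemannian metric. *)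
Definition riem {R : realType} {n} (g : mfun R n) (p : cspace R n) :
    'M[R[i]]_(n + n) := block_mx 0 (g p) (g p)^T 0.

(* omega(X, Y) = g(JX, Y) *)
Definition kahler_form {R : realType} {n} (g : mfun R n) : form R n 2 :=
  fun I p => (if is_hol (tnth I ord0) then 'i else - 'i) *
             riem g p (tnth I ord0) (tnth I ord_max).

Definition form20 {R : realType} {n} (b : mfun R n) : form R n 2 :=
  fun I p => (block_mx (b p) 0 0 0 : 'M[R[i]]_(n + n)) (tnth I ord0) (tnth I ord_max).

Definition pluriclosed {R : realType} {n} (g : mfun R n) (U : set (cspace R n)) :
    Prop :=
  forall I p, U p -> 'i * del (delbar (kahler_form g)) I p = 0.

(* H = d^c omega with d^c = sqrt(-1) (del - delbar).  For omega(X, Y) = g(JX, Y)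
   this is the sign for which D + 1/2 g^-1 H preserves J. *)
Definition torsionH {R : realType} {n} (g : mfun R n) : form R n 3 :=
  fun I p => 'i * (del (kahler_form g) I p - delbar (kahler_form g) I p).

(* Coefficient of d_C in D_(d_A) d_B. *)
Definition levi_civita {R : realType} {n} (g : mfun R n) (A B C : 'I_(n + n))
    (p : cspace R n) : R[i] :=
  \sum_D 2^-1 * (wderiv A (fun q => riem g q B D) p
                 + wderiv B (fun q => riem g q A D) p
                 - wderiv D (fun q => riem g q A B) p)
         * invmx (riem g p) D C.

Definition bismut {R : realType} {n} (g : mfun R n) (A B C : 'I_(n + n))
    (p : cspace R n) : R[i] :=
  levi_civita g A B C p
  + \sum_D 2^-1 * torsionH g [tuple A; B; D] p * invmx (riem g p) D C.

(* Coefficient of d_E in Omega^B(d_A, d_B) d_C, where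
   Omega^B(X, Y) = [nabla_X, nabla_Y] - nabla_[X, Y]. *)
Definition bismut_curv {R : realType} {n} (g : mfun R n)
    (A B C E : 'I_(n + n)) (p : cspace R n) : R[i] :=
  wderiv A (bismut g B C E) p - wderiv B (bismut g A C E) p
  + \sum_F (bismut g B C F p * bismut g A F E p
            - bismut g A C F p * bismut g B F E p).

(* The Bismut-Ricci form: sqrt(-1) times the trace of Omega^B over T^(1,0),
   the normalization for which rho_B = - sqrt(-1) del delbar log det g
   when g is Kahler. *)
Definition bismut_ricci {R : realType} {n} (g : mfun R n) : form R n 2 :=
  fun I p => 'i * \sum_(k < n)
    bismut_curv g (tnth I ord0) (tnth I ord_max) (hol n k) (hol n k) p.

(* The frame (Z^1 .. Z^n, W^1 .. W^n) of T^(1,0) + Lambda^(1,0) is indexed by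
   'I_(n + n).  The inverse metric g^(lbar k) is the entry (l, k) of the inverse
   matrix, so that g_(i lbar) g^(lbar k) = delta_i^k. *)

Definition gen_metric {R : realType} {n} (g b : mfun R n) (p : cspace R n) :
    'M[R[i]]_(n + n) :=
  let gi := invmx (g p) in
  block_mx
    (\matrix_(i, j) (g p i j + \sum_k \sum_l b p i k * (b p j l)^* * gi l k))
    (\matrix_(i, j) \sum_k gi j k * b p i k)
    (\matrix_(i, j) \sum_k gi k i * (b p j k)^*)
    (\matrix_(i, j) gi j i).

Definition chern_curv {R : realType} {n m} (G : cspace R n -> 'M[R[i]]_m)
    (i j : 'I_n) (A B : 'I_m) (p : cspace R n) : R[i] :=
  - wderiv (hol n i) (wderiv (ahol n j) (fun q => G q A B)) p
  + \sum_C \sum_D wderiv (hol n i) (fun q => G q A C) p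
                  * invmx (G p) C D
                  * wderiv (ahol n j) (fun q => G q D B) p.

Definition curv_trace {R : realType} {n m} (g : mfun R n)
    (G : cspace R n -> 'M[R[i]]_m) (A B : 'I_m) (p : cspace R n) : R[i] :=
  \sum_i \sum_j invmx (g p) j i * chern_curv G i j A B p.

Record complex_manifold (R : realType) (n : nat) := ComplexManifold {
  carrier :> topologicalType;
  chart : Type;
  dom : chart -> set carrier;
  coord : chart -> carrier -> cspace R n;
  param : chart -> cspace R n -> carrier;
  manifold_hausdorff : hausdorff_space carrier;
  manifold_countable : @second_countable carrier;
  dom_cover : forall x, exists c, dom c x;
  dom_open : forall c, open (dom c);
  im_open : forall c, open (coord c @` dom c);
  coord_continuous : forall c, {within dom c, continuous (coord c)};
  param_continuous : forall c, {within coord c @` dom c, continuous (param c)};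
  coordK : forall c, {in dom c, cancel (coord c) (param c)};
  transition_holomorphic : forall c d k,
    holomorphic (coord c @` (dom c `&` dom d))
                (fun p => zcoord k (coord d (param c p)))
}.

Definition chart_im {R : realType} {n} {M : complex_manifold R n} (c : chart M) :
  set (cspace R n) := coord c @` dom c.

Definition overlap {R : realType} {n} {M : complex_manifold R n}
  (c d : chart M) : set (cspace R n) := coord c @` (dom c `&` dom d).

Definition transition {R : realType} {n} {M : complex_manifold R n}
  (c d : chart M) (p : cspace R n) : cspace R n := coord d (param c p).

(* Entry (i, k) is the derivative of the k-th complex coordinate of d along the
   i-th coordinate vector of c. *)
Definition jac {R : realType} {n} {M : complex_manifold R n} (c d : chart M)
    (p : cspace R n) : 'M[R[i]]_n :=
  \matrix_(i, k) wderiv (hol n i) (fun q => zcoord k (transition c d q)) p.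

(* Component matrices of a tensor field, one for each chart. *)
Definition components {R : realType} {n} (M : complex_manifold R n) :=
  chart M -> mfun R n.

Definition hermitian_metric {R : realType} {n} (M : complex_manifold R n)
    (g : components M) : Prop :=
  [/\ forall c i j, csmooth (chart_im c) (fun p => g c p i j),
      forall c p, chart_im c p -> herm_posdef (g c p) &
      forall c d p, overlap c d p ->
        g c p = jac c d p *m g d (transition c d p) *m adj (jac c d p)].

Definition smooth_form20 {R : realType} {n} (M : complex_manifold R n)
    (b : components M) : Prop :=
  [/\ forall c i j, csmooth (chart_im c) (fun p => b c p i j),
      forall c p, chart_im c p -> (b c p)^T = - b c p &
      forall c d p, overlap c d p ->
        b c p = jac c d p *m b d (transition c d p) *m (jac c d p)^T].

(* f has derivative l at t relative to I (one-sided at an end point of I). *)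
Definition deriv_in {R : realType} (I : interval R) (f : R -> R[i]) (t : R)
    (l : R[i]) : Prop :=
  let D := within [set h | t + h \in I] (dnbhs (0 : R)) in
  (h^-1 * (complex.Re (f (t + h)) - complex.Re (f t)) @[h --> D] --> complex.Re l)
  /\
  (h^-1 * (complex.Im (f (t + h)) - complex.Im (f t)) @[h --> D] --> complex.Im l).

(* The sign in the torsion potential condition is forced by the flow equations:
   d rho_B = 0 gives d/dt (del omega) = - del rho_B^(1,1) = delbar rho_B^(2,0)
   and d/dt (delbar beta) = - delbar rho_B^(2,0), so it is
   del omega + delbar beta that is preserved. *)
Definition torsion_potential {R : realType} {n} (g b : mfun R n)
    (U : set (cspace R n)) : Prop :=
  forall I p, U p -> delbar (form20 b) I p = - del (kahler_form g) I p.

Definition pluriclosed_flow {R : realType} {n} (M : complex_manifold R n)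
    (T : interval R) (g b : R -> components M) : Prop :=
  forall t, t \in T ->
  [/\ hermitian_metric (g t), smooth_form20 (b t),
      forall c, pluriclosed (g t c) (chart_im c),
      forall c, torsion_potential (g t c) (b t c) (chart_im c) &
      forall c I p, chart_im c p ->
        deriv_in T (fun s => kahler_form (g s c) I p) t
                 (- form_part 1 1 (bismut_ricci (g t c)) I p) /\
        deriv_in T (fun s => form20 (b s c) I p) t
                 (- form_part 2 0 (bismut_ricci (g t c)) I p)].

(* Main.v *)
(* With h = g^-1 and k = h^T, the generalized metric factors as
   G = P diag(g, k) P^*, where P = [[1, b], [0, 1]].  Conjugating by P^-1 makes b
   vanish at the point without affecting its derivatives, so dG/dt becomes
     [[g', b' k], [k b'^*, - k g'^T k]],
   and the Chern curvature of G becomes a 2 x 2 block matrix in the derivatives of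
   g and b.  The torsion potential turns d_jbar b into the Chern torsion of g.
   The Bismut-Ricci form is sqrt(-1) times the exterior derivative of the trace
   connection form, because the Bismut connection preserves T^(1,0).  The
   pluriclosed condition enters only through the (1,1) block; the (1,2) block,
   which matches rho_B^(2,0), is a formal identity, the (2,1) block is its adjoint,
   and the (2,2) block follows from the (1,1) block by transposition since b is
   antisymmetric. *)
Require Import Defs.
From mathcomp Require Import all_boot all_order all_algebra.
From mathcomp Require Import complex.
From mathcomp Require Import all_classical all_reals all_analysis.
From mathcomp Require Import perm ring.

Set Implicit Arguments.
Unset Strict Implicit.
Unset Printing Implicit Defensive.

Import Order.TTheory GRing.Theory Num.Theory.
Import numFieldNormedType.Exports.
Local Open Scope classical_set_scope.
Local Open Scope ring_scope.

(** * Derivations at a point *)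

(** The factorization of G is differentiated in time, along the coordinate vectors, and along them a
    second time; the product and inverse rules are therefore proved once, from the axioms of this
    record, and [mder_gauge] serves all three uses. Conjugation by P^-1 is not a change of
    holomorphic frame: b is not holomorphic, and its antiholomorphic derivatives are what carries
    the torsion. They stay manageable because a derivative of P is strictly block triangular, hence
    fixed under multiplication by P, and can be moved between the outer factors. In the (1,1) block
    the term quadratic in the derivatives of b becomes quadratic in those of g. The constants -i and
    i of the torsion potential and of its adjoint multiply to 1, which is what lets this term match
    the Bismut-Ricci form, whose quadratic terms come from differentiating the inverse metric. *)

(* A relation, so that [D f l] carries differentiability: [f] has derivative [l]
   at [x].  The instances are the derivative in time relative to an interval and
   the Wirtinger derivatives. *)
Record derivation_at (K : fieldType) (X : Type) (x : X) := DerivationAt {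
  germ : set_system X;
  germ_filter : Filter germ;
  der :> (X -> K) -> K -> Prop;
  der_germ : forall f g l,
    germ [set y | f y = g y] -> f x = g x -> der f l -> der g l;
  der_cst : forall a, der (fun=> a) 0;
  derD : forall f g l m, der f l -> der g m ->
    der (fun y => f y + g y) (l + m);
  derM : forall f g l m, der f l -> der g m ->
    der (fun y => f y * g y) (l * g x + f x * m);
  derV : forall f l, f x != 0 -> der f l ->
    der (fun y => (f y)^-1) (- ((f x)^-1 * l * (f x)^-1))
}.
#[global] Existing Instance germ_filter.

Lemma der_eq (K : fieldType) (X : Type) (x : X) (D : derivation_at K x)
    (f g : X -> K) (l m : K) : D f l -> f =1 g -> l = m -> D g m.
Proof. by move=> fl /funext <- <-. Qed.

Lemma derN (K : fieldType) (X : Type) (x : X) (D : derivation_at K x)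
    (f : X -> K) (l : K) : D f l -> D (fun y => - f y) (- l).
Proof.
move=> fl; apply: (der_eq (derM (der_cst D (-1)) fl)) => [y|].
  by rewrite mulN1r.
by rewrite mul0r add0r mulN1r.
Qed.

Section RealDerivations.
Variable R : realType.

(** Spelled like the two clauses of [deriv_in], so that [complexify] of the resulting derivation is
    [deriv_in] by conversion. *)
Definition quotient_in (I : interval R) (t : R) (f : R -> R) (l : R) :=
  h^-1 * (f (t + h) - f t) @[h --> within [set h | t + h \in I] (0 : R)^'] --> l.

Lemma near_within_shift (I : interval R) (t : R) (P : set R) :
  within [set` I] (nbhs t) P ->
  \forall h \near within [set h | t + h \in I] (0 : R)^', P (t + h).
Proof.
move=> nP; have : t + h @[h --> (0 : R)] --> t.
  rewrite -[X in _ --> X]addr0; apply: cvgD; [exact: cvg_cst | exact: cvg_id].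
move=> /(_ _ nP) tP; rewrite /prop_near1 /within /=.
by apply: (@filterS _ (nbhs (0 : R)) _ _ _ _ tP) => h hP _; exact: hP.
Qed.

Lemma quotient_in_continuous I t f l : quotient_in I t f l ->
  f (t + h) @[h --> within [set h | t + h \in I] (0 : R)^'] --> f t.
Proof.
set F := within _ _ => fl.
have h0 : h @[h --> F] --> (0 : R).
  by move=> A A0; do 2!apply: cvg_within.
have : f t + h * (h^-1 * (f (t + h) - f t)) @[h --> F] --> f t + 0 * l.
  by apply: cvgD; [exact: cvg_cst | exact: cvgM].
rewrite mul0r addr0; apply: cvg_trans; apply: near_eq_cvg.
have : \forall h \near F, h != 0.
  by apply: cvg_within; exact: withinT.
apply: filterS => h h0' /=.
by rewrite mulrA divff// mul1r addrC subrK.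
Qed.

(** The germ is taken relative to I because the metric is known to be invertible only at times of I.
    Since nothing forces t to lie in I, such a germ does not determine the value at t; this is why
    [der_germ] asks for agreement at the point separately. *)
Definition interval_derivation (I : interval R) (t : R) :
  derivation_at R t.
Proof.
apply: (@DerivationAt _ _ _ (within [set` I] (nbhs t)) _ (quotient_in I t)).
- move=> f g l fg fgt; rewrite /quotient_in; apply: cvg_trans.
  apply: near_eq_cvg; move/near_within_shift: fg; apply: filterS => h /= ->.
  by rewrite fgt.
- move=> a; apply: cvg_near_cst; apply: nearW => h.
  by rewrite subrr mulr0.
- move=> f g l m fl gm; rewrite /quotient_in.
  under eq_fun do rewrite opprD addrACA mulrDr.
  exact: cvgD.
- move=> f g l m fl gm; rewrite /quotient_in.
  have -> : (fun h => h^-1 * (f (t + h) * g (t + h) - f t * g t)) =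
    (fun h => h^-1 * (f (t + h) - f t) * g (t + h)
              + f t * (h^-1 * (g (t + h) - g t))).
    by apply/funext => h; ring.
  apply: cvgD; apply: cvgM => //; last exact: cvg_cst.
  exact: quotient_in_continuous gm.
- move=> f l ft0 fl; rewrite /quotient_in.
  have fc := quotient_in_continuous fl.
  have : - ((f t)^-1 * (h^-1 * (f (t + h) - f t)) * (f (t + h))^-1)
     @[h --> within [set h | t + h \in I] (0 : R)^'] -->
     - ((f t)^-1 * l * (f t)^-1).
    apply: cvgN; apply: cvgM; last exact: cvgV.
    by apply: cvgM => //; exact: cvg_cst.
  apply: cvg_trans; apply: near_eq_cvg.
  have : \forall h \near within [set h | t + h \in I] (0 : R)^', f (t + h) != 0.
    exact: (cvgr_neq0 _ fc ft0).
  have : \forall h \near within [set h | t + h \in I] (0 : R)^', h != 0.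
    by apply: cvg_within; exact: withinT.
  by apply: filterS2 => h h0 fh0 /=; field; rewrite h0 fh0 ft0.
Defined.

Definition directional_derivation (V : normedModType R) (v p : V) :
  derivation_at R p.
Proof.
apply: (@DerivationAt R V p (nbhs p) _
  (fun f l => is_derive p v (f : V -> R) (l : R))).
- by move=> f g l fg _; exact: near_eq_is_derive.
- by move=> a; exact: is_derive_cst.
- by move=> f g l m fl gm; exact: is_deriveD.
- move=> f g l m fl gm; apply: (is_derive_eq (is_deriveM fl gm)).
  by rewrite /GRing.scale /=; ring.
- move=> f l f0 [fd <-]; apply: DeriveDef; first exact: derivableV.
  by rewrite deriveV // /GRing.scale /=; field.
Defined.

Variables (X : Type) (x : X).

Definition complexify (D : derivation_at R x) : derivation_at R[i] x.
Proof.
pose dc (f : X -> R[i]) (l : R[i]) :=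
  D (fun y => complex.Re (f y)) (complex.Re l) /\
  D (fun y => complex.Im (f y)) (complex.Im l).
apply: (@DerivationAt _ _ _ (germ D) _ dc) => //.
- move=> f g l fg fgx [fr fi]; split.
    by apply: der_germ fr; rewrite ?fgx //; apply: filterS fg => y /= ->.
  by apply: der_germ fi; rewrite ?fgx //; apply: filterS fg => y /= ->.
- by move=> a; split; exact: der_cst.
- move=> f g l m [fr fi] [gr gi]; split.
    apply: (der_eq (derD fr gr)) => [y|].
      by case: (f y) (g y) => ? ? [].
    by case: l m {fr fi gr gi} => ? ? [].
  apply: (der_eq (derD fi gi)) => [y|].
    by case: (f y) (g y) => ? ? [].
  by case: l m {fr fi gr gi} => ? ? [].
- move=> f g l m [fr fi] [gr gi]; split.
    apply: (der_eq (derD (derM fr gr) (derN (derM fi gi)))) => [y|].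
      by case: (f y) (g y) => ? ? [].
    move: l m (f x) (g x) {fr fi gr gi} => [? ?] [? ?] [? ?] [? ?] /=.
    by ring.
  apply: (der_eq (derD (derM fr gi) (derM fi gr))) => [y|].
    by case: (f y) (g y) => ? ? [].
  move: l m (f x) (g x) {fr fi gr gi} => [? ?] [? ?] [? ?] [? ?] /=.
  by ring.
- move=> f l f0 [fr fi].
  (* The inverse is the conjugate divided by the squared modulus, so the latter must not vanish at
     x. *)
  have n0 : complex.Re (f x) * complex.Re (f x)
            + complex.Im (f x) * complex.Im (f x) != 0.
    case: (f x) f0 => a b /=; apply: contraNneq.
    rewrite -!expr2 => /eqP; rewrite paddr_eq0 ?sqr_ge0 // !sqrf_eq0.
    by case/andP => /eqP -> /eqP ->.
  have dn := derD (derM fr fr) (derM fi fi).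
  have {}dn := @derV _ _ _ D (fun y => complex.Re (f y) * complex.Re (f y)
    + complex.Im (f y) * complex.Im (f y)) _ n0 dn.
  split.
    apply: (der_eq (derM fr dn)) => [y|].
      by case: (f y) => ? ? /=; rewrite !expr2.
    move: (f x) n0 l {fr fi dn f0} => [a b] + [? ?] /=.
    by rewrite !expr2 => n0; field.
  apply: (der_eq (derM (derN fi) dn)) => [y|].
    by case: (f y) => ? ? /=; rewrite !expr2 mulNr.
  move: (f x) n0 l {fr fi dn f0} => [a b] + [? ?] /=.
  by rewrite !expr2 => n0; field.
Defined.

End RealDerivations.

Section DerivationCalculus.
Variables (K : fieldType) (X : Type) (x : X) (D : derivation_at K x).

Lemma der_sum (I : Type) (r : seq I) (P : pred I) (f : I -> X -> K)
    (l : I -> K) : (forall i, D (f i) (l i)) ->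
  D (fun y => \sum_(i <- r | P i) f i y) (\sum_(i <- r | P i) l i).
Proof.
move=> fl; elim: r => [|i r IH].
  by apply: der_eq (der_cst D 0) _ _ => [y|]; rewrite big_nil.
case: (boolP (P i)) => Pi.
  by apply: der_eq (derD (fl i) IH) _ _ => [y|]; rewrite big_cons Pi.
by apply: der_eq IH _ _ => [y|]; rewrite big_cons (negPf Pi).
Qed.

Lemma derB f g l m : D f l -> D g m -> D (fun y => f y - g y) (l - m).
Proof. by move=> fl gm; exact: derD (derN gm). Qed.

Lemma derMl a f l : D f l -> D (fun y => a * f y) (a * l).
Proof.
move=> fl; apply: der_eq (derM (der_cst D a) fl) _ _ => [y//|].
by rewrite mul0r add0r.
Qed.

Lemma der_prod_ex (I : Type) (r : seq I) (P : pred I) (f : I -> X -> K) :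
  (forall i, exists l, D (f i) l) ->
  exists l, D (fun y => \prod_(i <- r | P i) f i y) l.
Proof.
move=> fl; elim: r => [|i r [l IH]].
  by exists 0; apply: der_eq (der_cst D 1) _ _ => // y; rewrite big_nil.
case: (boolP (P i)) => Pi.
  have [m fm] := fl i.
  eexists; apply: der_eq (derM fm IH) _ erefl => y.
  by rewrite big_cons Pi.
by exists l; apply: der_eq IH _ _ => // y; rewrite big_cons (negPf Pi).
Qed.

(** Existence suffices: through Cramer's rule it gives the entries of an inverse matrix some
    derivative, and [mderV] finds its value by another route. *)
Lemma der_det_ex n (F : X -> 'M[K]_n) :
  (forall i j, exists l, D (fun y => F y i j) l) ->
  exists l, D (fun y => \det (F y)) l.
Proof.
move=> Fl.
have /choice[l Hl] : forall s : {perm 'I_n}, exists l,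
    D (fun y => (-1) ^+ s * \prod_i F y i (s i)) l.
  move=> s; have [l Hl] := der_prod_ex (index_enum _) xpredT
    (fun i => Fl i (s i)).
  by eexists; exact: derMl Hl.
by eexists; exact: der_sum Hl.
Qed.

Definition mder m n (F : X -> 'M[K]_(m, n)) (L : 'M[K]_(m, n)) :=
  forall i j, D (fun y => F y i j) (L i j).

Lemma mder_eq m n (F G : X -> 'M[K]_(m, n)) L M :
  mder F L -> F =1 G -> L = M -> mder G M.
Proof. by move=> FL /funext <- <-. Qed.

Lemma mder_germ m n (F G : X -> 'M[K]_(m, n)) L :
  germ D [set y | F y = G y] -> F x = G x -> mder F L -> mder G L.
Proof.
move=> FG FGx FL i j; apply: der_germ (FL i j); last by rewrite FGx.
by apply: filterS FG => y /= ->.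
Qed.

Lemma mder_cst m n (A : 'M[K]_(m, n)) : mder (fun=> A) 0.
Proof. by move=> i j; rewrite mxE; exact: der_cst. Qed.

Lemma mderD m n (F G : X -> 'M[K]_(m, n)) L M :
  mder F L -> mder G M -> mder (fun y => F y + G y) (L + M).
Proof.
move=> FL GM i j; apply: der_eq (derD (FL i j) (GM i j)) _ _ => [y|];
  by rewrite mxE.
Qed.

Lemma mderN m n (F : X -> 'M[K]_(m, n)) L :
  mder F L -> mder (fun y => - F y) (- L).
Proof.
by move=> FL i j; apply: der_eq (derN (FL i j)) _ _ => [y|]; rewrite mxE.
Qed.

Lemma mder_tr m n (F : X -> 'M[K]_(m, n)) L :
  mder F L -> mder (fun y => (F y)^T) L^T.
Proof.
by move=> FL i j; apply: der_eq (FL j i) _ _ => [y|]; rewrite mxE.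
Qed.

Lemma mderM m n p (F : X -> 'M[K]_(m, n)) (G : X -> 'M[K]_(n, p)) L M :
  mder F L -> mder G M ->
  mder (fun y => F y *m G y) (L *m G x + F x *m M).
Proof.
move=> FL GM i j.
have H k := derM (FL i k) (GM k j).
apply: der_eq (der_sum (index_enum _) xpredT H) _ _ => [y|].
  by rewrite mxE.
by rewrite !mxE -big_split.
Qed.

Lemma mder_block m1 m2 n1 n2 (F : X -> 'M[K]_(m1, n1))
    (G : X -> 'M[K]_(m1, n2)) (H : X -> 'M[K]_(m2, n1))
    (I : X -> 'M[K]_(m2, n2)) L M N O :
  mder F L -> mder G M -> mder H N -> mder I O ->
  mder (fun y => block_mx (F y) (G y) (H y) (I y)) (block_mx L M N O).
Proof.
move=> FL GM HN IO i j.
case: (split_ordP i) => i' ->; case: (split_ordP j) => j' ->.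
- by apply: der_eq (FL i' j') _ _ => [y|]; rewrite block_mxEul.
- by apply: der_eq (GM i' j') _ _ => [y|]; rewrite block_mxEur.
- by apply: der_eq (HN i' j') _ _ => [y|]; rewrite block_mxEdl.
- by apply: der_eq (IO i' j') _ _ => [y|]; rewrite block_mxEdr.
Qed.

Lemma mderV n (F : X -> 'M[K]_n) L :
  germ D [set y | F y \in unitmx] -> F x \in unitmx -> mder F L ->
  mder (fun y => invmx (F y)) (- (invmx (F x) *m L *m invmx (F x))).
Proof.
move=> nF xF FL.
have Fex i j : exists l, D (fun y => F y i j) l by exists (L i j).
have /choice[l Hl] : forall ij : 'I_n * 'I_n, exists l,
    D (fun y => invmx (F y) ij.1 ij.2) l.
  move=> [i j] /=; have [d Hd] := der_det_ex Fex.
  have [c Hc] : exists l, D (fun y => cofactor (F y) j i) l.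
    rewrite /cofactor; have [|c Hc] := @der_det_ex n.-1
      (fun y => row' j (col' i (F y))).
      move=> k m; exists (L (lift j k) (lift i m)).
      by apply: der_eq (FL _ _) _ _ => // y; rewrite !mxE.
    by eexists; exact: derMl Hc.
  have d0 : \det (F x) != 0 by rewrite -unitfE -unitmxE.
  have H := derM (@derV _ _ _ D (fun y => \det (F y)) _ d0 Hd) Hc.
  eexists; apply: der_germ H.
    by apply: filterS nF => y Fy /=; rewrite /invmx Fy !mxE.
  by rewrite /invmx xF !mxE.
pose M : 'M[K]_n := \matrix_(i, j) l (i, j).
have VM : mder (fun y => invmx (F y)) M.
  by move=> i j; apply: der_eq (Hl (i, j)) _ _; rewrite ?mxE.
(* inv = 2 inv - inv F inv: the unknown derivative M of inv cancels on the
   right-hand side, so no uniqueness of derivatives is needed. *)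
have := mderD (mderD VM VM) (mderN (mderM (mderM VM FL) VM)).
move=> /(mder_germ _ _) H; apply: mder_eq (H _ _ _) _ _ => //.
- apply: filterS nF => y Fy /=; rewrite mulVmx// mul1mx addrK; exact: erefl.
- by rewrite mulVmx// mul1mx addrK.
- rewrite mulVmx// mul1mx mulmxDl -!mulmxA mulmxV// mulmx1.
  by rewrite opprD addrACA subrr addr0 opprD addrA subrr add0r.
Qed.
End DerivationCalculus.

(** * Symmetry of second derivatives *)

Section Schwarz.
Variables (R : realType) (V : normedModType R).
Implicit Types (f : V -> R) (v w p q : V).

Lemma is_derive_line f v q (s : R) : derivable f (s *: v + q) v ->
  is_derive s 1 (fun t : R => f (t *: v + q)) ('D_v f (s *: v + q)).
Proof.
have E : (fun h : R => h^-1 *: (f (h *: v + (s *: v + q)) - f (s *: v + q))) =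
    (fun h : R => h^-1 *: (f ((h *: 1 + s) *: v + q) - f (s *: v + q))).
  by apply/funext => h; rewrite addrA -scalerDl /GRing.scale /= mulr1.
move=> fd; apply: DeriveDef; last by rewrite /derive /comp /shift /= -E.
by move: fd; rewrite /derivable /comp /shift /= -E.
Qed.

Lemma mvt_closed (F dF : R -> R) (h : R) : 0 < h ->
  (forall t, 0 <= t <= h -> is_derive t 1 F (dF t)) ->
  exists2 t, 0 <= t <= h & F h - F 0 = dF t * h.
Proof.
move=> h0 FdF; have H1 t : t \in `]0, h[%R -> is_derive t 1 F (dF t).
  by rewrite in_itv /= => /andP[? ?]; apply: FdF; rewrite !ltW.
have H2 : {within `[0, h], continuous F}%classic.
  apply: derivable_within_continuous => t; rewrite in_itv /= => th.
  by have [] := FdF t th.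
have [t] := MVT h0 H1 H2; rewrite in_itv /= subr0 => /andP[? ?] ->.
by exists t; rewrite ?ltW.
Qed.

(** The mean value theorem twice: along v for the difference of f between two opposite sides of the
    parallelogram, then along w for ['D_v f]. *)
Lemma mvt_square f v w p (h : R) (U : set V) : 0 < h ->
  (forall s t, 0 <= s <= h -> 0 <= t <= h -> U (s *: v + (t *: w + p))) ->
  (forall q, U q -> derivable f q v) ->
  (forall q, U q -> derivable ('D_v f) q w) ->
  exists s t, [/\ 0 <= s <= h, 0 <= t <= h &
   f (h *: v + (h *: w + p)) - f (h *: v + p) - (f (h *: w + p) - f p) =
   h * h * 'D_w ('D_v f) (s *: v + (t *: w + p))].
Proof.
move=> h0 sqU dv dw.
have sqU0 s : 0 <= s <= h -> U (s *: v + p).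
  by move=> sh; rewrite -[p]add0r -(scale0r w); apply: sqU => //; rewrite lexx ltW.
have dF s : 0 <= s <= h -> is_derive s 1
    (fun t : R => f (t *: v + (h *: w + p)) - f (t *: v + p))
    ('D_v f (s *: v + (h *: w + p)) - 'D_v f (s *: v + p)).
  move=> sh; apply: is_deriveB; apply: is_derive_line; apply: dv; last exact: sqU0.
  by apply: sqU => //; rewrite lexx ltW.
have [s sh Es] := mvt_closed h0 dF.
have dG t : 0 <= t <= h -> is_derive t 1
    (fun t : R => 'D_v f (t *: w + (s *: v + p)))
    ('D_w ('D_v f) (t *: w + (s *: v + p))).
  by move=> th; apply: is_derive_line; apply: dw; rewrite addrCA; exact: sqU.
have [t th Et] := mvt_closed h0 dG.
exists s, t; split=> [//|//|].
move: Es Et; rewrite !scale0r !add0r (addrCA (h *: w)) => -> ->.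
by rewrite (addrCA (t *: w)); ring.
Qed.

Lemma square_in_nbhs p v w (Q : set V) : nbhs p Q ->
  exists2 h : R, 0 < h & forall s t, 0 <= s <= h -> 0 <= t <= h ->
    Q (s *: v + (t *: w + p)).
Proof.
move=> /nbhs_ballP[e /= e0 Qe].
(* The summand 1 keeps c positive when v and w both vanish. *)
pose c := `|v| + `|w| + 1.
have c0 : 0 < c by rewrite ltr_wpDl // addr_ge0.
exists (e / c / 2) => [|s t /andP[s0 sh] /andP[t0 th]]; first by rewrite !divr_gt0.
apply: Qe; rewrite -ball_normE /ball_ /= addrA opprD addrCA subrr addr0 normrN.
rewrite (le_lt_trans (ler_normD _ _)) // !normrZ !ger0_norm //.
have : s * `|v| + t * `|w| <= e / c / 2 * (`|v| + `|w|).
  by rewrite mulrDr lerD // ler_wpM2r.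
move=> /le_lt_trans; apply.
have : `|v| + `|w| < c by rewrite ltrDl.
move=> vwc; have : e / c / 2 * (`|v| + `|w|) < e / c / 2 * c.
  by rewrite ltr_pM2l // !divr_gt0.
move=> /lt_trans; apply.
have -> : e / c / 2 * c = e / 2 by field; rewrite gt_eqF.
by rewrite ltr_pdivrMr // ltr_pMr // ltr1n.
Qed.

(** The second difference of f over a small parallelogram is symmetric in v and w. By [mvt_square]
    it is h^2 times either mixed derivative, each at its own point of the parallelogram, and
    continuity brings both points back to p. *)
Lemma Ck_open_schwarz (U : set V) f v w p : open U -> Ck 2 U f -> U p ->
  'D_w ('D_v f) p = 'D_v ('D_w f) p.
Proof.
move=> oU [_ C2] Up.
have [dv [_ C1v]] := C2 v; have [dw [_ C1w]] := C2 w.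
have [dwv [cwv _]] := C1v w; have [dvw [cvw _]] := C1w v.
apply/eqP; rewrite -subr_eq0 -normr_le0; apply/ler_addgt0Pl => e e0.
rewrite addr0.
have nU : nbhs p U by exact: open_nbhs_nbhs.
have e20 : 0 < e / 2 by rewrite divr_gt0.
have /cvgr_dist_lt/(_ _ e20) n1 := cwv p Up.
have /cvgr_dist_lt/(_ _ e20) n2 := cvw p Up.
have [h h0 sq] := square_in_nbhs v w (filterI nU (filterI n1 n2)).
have [s [t [sh th E1]]] := mvt_square h0 (fun s t sh th => (sq s t sh th).1) dv dwv.
have sq' t' s' : 0 <= t' <= h -> 0 <= s' <= h -> U (t' *: w + (s' *: v + p)).
  by move=> ? ?; rewrite addrCA; exact: (sq _ _ _ _).1.
have [t' [s' [th' sh' E2]]] := mvt_square h0 sq' dw dvw.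
have h20 : h * h != 0 by rewrite mulf_neq0 // gt_eqF.
have cancel (x y l m : R) : l = h * h * x -> m = h * h * y -> l = m -> x = y.
  by move=> -> ->; exact: mulfI.
have E : 'D_w ('D_v f) (s *: v + (t *: w + p)) =
         'D_v ('D_w f) (t' *: w + (s' *: v + p)).
  apply: cancel E1 E2 _; rewrite (addrCA (h *: w) (h *: v) p).
  move: (f _) (f _) (f _) (f p) => x y z u; ring.
have l1 : `|'D_w ('D_v f) p - 'D_w ('D_v f) (s *: v + (t *: w + p))| < e / 2.
  exact: (sq s t sh th).2.1.
have l2 : `|'D_v ('D_w f) p - 'D_v ('D_w f) (t' *: w + (s' *: v + p))| < e / 2.
  by rewrite (addrCA (t' *: w) (s' *: v) p); exact: (sq s' t' sh' th').2.2.
have tri (x y z : R) : `|x - z| < e / 2 -> `|y - z| < e / 2 -> `|x - y| <= e.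
  move=> xz yz; apply: le_trans (ler_distD z x y) _; rewrite (distrC z y).
  by apply: le_trans (lerD (ltW xz) (ltW yz)) _; rewrite -splitr lexx.
by apply: tri l1 _; rewrite E.
Qed.

End Schwarz.

(** * Wirtinger derivatives *)

Lemma complexify_conj (R : realType) (X : Type) (x : X)
    (D : derivation_at R x) (f : X -> R[i]) (l : R[i]) :
  complexify D f l -> complexify D (fun y => (f y)^*%C) (l^*%C).
Proof.
case=> fr fi; split.
  by apply: der_eq fr _ _ => [y|]; [case: (f y)|case: (l)].
by apply: der_eq (derN fi) _ _ => [y|]; [case: (f y)|case: (l)].
Qed.

Section Wirtinger.
Variables (R : realType) (n : nat).
Implicit Types (f g : cspace R n -> R[i]) (p : cspace R n) (A B : 'I_(n + n)).

Definition axis A : 'I_n :=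
  match fintype.split A with inl k => k | inr k => k end.

Definition conj_idx A : 'I_(n + n) :=
  match fintype.split A with inl k => ahol n k | inr k => hol n k end.

Lemma conj_idx_hol (k : 'I_n) : conj_idx (hol n k) = ahol n k.
Proof. by rewrite /conj_idx -[lshift n k]/(unsplit (inl k)) unsplitK. Qed.

Lemma conj_idx_ahol (k : 'I_n) : conj_idx (ahol n k) = hol n k.
Proof. by rewrite /conj_idx -[rshift n k]/(unsplit (inr k)) unsplitK. Qed.

(** The linear combination of an x-derivative and a y-derivative that defines [wderiv]. Isolating it
    lets the rules of calculus pass from real partial derivatives to Wirtinger derivatives by
    linearity alone. *)
Definition wcomb A (a b : R[i]) : R[i] :=
  match fintype.split A with
  | inl _ => 2^-1 * (a - 'i * b)
  | inr _ => 2^-1 * (a + 'i * b)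
  end.

Lemma wderivE A f p :
  wderiv A f p =
  wcomb A (pderiv (hol n (axis A)) f p) (pderiv (ahol n (axis A)) f p).
Proof. by rewrite /wderiv /wcomb /axis; case: fintype.split. Qed.

Lemma wcombD A a b c d : wcomb A (a + b) (c + d) = wcomb A a c + wcomb A b d.
Proof. by rewrite /wcomb; case: fintype.split => _; ring. Qed.

Lemma wcombMl A a c d : wcomb A (a * c) (a * d) = a * wcomb A c d.
Proof. by rewrite /wcomb; case: fintype.split => _; ring. Qed.

Lemma wcombMr A a c d : wcomb A (c * a) (d * a) = wcomb A c d * a.
Proof. by rewrite /wcomb; case: fintype.split => _; ring. Qed.

Lemma wcombN A a b : wcomb A (- a) (- b) = - wcomb A a b.
Proof. by rewrite /wcomb; case: fintype.split => _; ring. Qed.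

Lemma wcomb0 A : wcomb A 0 0 = 0.
Proof. by rewrite /wcomb; case: fintype.split => _; ring. Qed.

Lemma wcombC A B a b c d :
  wcomb A (wcomb B a b) (wcomb B c d) = wcomb B (wcomb A a c) (wcomb A b d).
Proof.
by rewrite /wcomb; case: (fintype.split A) (fintype.split B) => _ [] _; ring.
Qed.

Lemma axis_conj_idx A : axis (conj_idx A) = axis A.
Proof.
rewrite {2}/axis /conj_idx; case: (fintype.split A) => k; rewrite /axis.
  by rewrite -[rshift n k]/(unsplit (inr k)) unsplitK.
by rewrite -[lshift n k]/(unsplit (inl k)) unsplitK.
Qed.

Lemma wcomb_conj A a b : (wcomb A a b)^*%C = wcomb (conj_idx A) (a^*%C) (b^*%C).
Proof.
have i_conj : ('i : R[i])^*%C = - 'i.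
  by apply/eqP; rewrite eq_complex /= oppr0 !eqxx.
have cM (x y : R[i]) : (x * y)^*%C = x^*%C * y^*%C by exact: rmorphM.
have cD (x y : R[i]) : (x + y)^*%C = x^*%C + y^*%C by exact: rmorphD.
have cB (x y : R[i]) : (x - y)^*%C = x^*%C - y^*%C by exact: rmorphB.
have h_conj : (2^-1 : R[i])^*%C = 2^-1 by rewrite conjc_inv conjc_nat.
rewrite /wcomb /conj_idx; case: (fintype.split A) => k.
  rewrite -[rshift n k]/(unsplit (inr k)) unsplitK.
  by rewrite cM cB cM h_conj i_conj; ring.
rewrite -[lshift n k]/(unsplit (inl k)) unsplitK.
by rewrite cM cD cM h_conj i_conj; ring.
Qed.

Definition axis_derivation A p : derivation_at R[i] p :=
  complexify (directional_derivation (delta_mx 0 A) p).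

Lemma pderiv_eq A f p l : axis_derivation A p f l -> pderiv A f p = l.
Proof. by case=> -[_ rl] [_ il]; rewrite /pderiv rl il; case: l {rl il}. Qed.

Definition wirtinger A p : derivation_at R[i] p.
Proof.
pose d f l := exists a b, [/\ axis_derivation (hol n (axis A)) p f a,
  axis_derivation (ahol n (axis A)) p f b & l = wcomb A a b].
apply: (@DerivationAt _ _ _ (nbhs p) _ d).
- move=> f g l fg fgp [a [b [fa fb ->]]]; exists a, b; split => //.
    exact: der_germ fa.
  exact: der_germ fb.
- by move=> a; exists 0, 0; split; rewrite ?wcomb0 //; exact: der_cst.
- move=> f g _ _ [a [b [fa fb ->]]] [c [e [gc ge ->]]].
  by exists (a + c), (b + e); split; rewrite ?wcombD //; exact: derD.
- move=> f g _ _ [a [b [fa fb ->]]] [c [e [gc ge ->]]].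
  exists (a * g p + f p * c), (b * g p + f p * e).
  by split; rewrite ?wcombD ?wcombMl ?wcombMr //; exact: derM.
- move=> f _ f0 [a [b [fa fb ->]]].
  exists (- ((f p)^-1 * a * (f p)^-1)), (- ((f p)^-1 * b * (f p)^-1)).
  by split; rewrite ?wcombN ?wcombMr ?wcombMl //; exact: derV.
Defined.

Lemma wderiv_eq A f p l : wirtinger A p f l -> wderiv A f p = l.
Proof.
by case=> a [b [fa fb ->]]; rewrite wderivE (pderiv_eq fa) (pderiv_eq fb).
Qed.

Lemma wirtinger_conj A f p l : wirtinger A p f l ->
  wirtinger (conj_idx A) p (fun q => (f q)^*%C) (l^*%C).
Proof.
case=> a [b [fa fb ->]]; exists (a^*%C), (b^*%C); rewrite wcomb_conj.
rewrite axis_conj_idx.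
by split=> //; exact: complexify_conj.
Qed.

Section Smooth.
Variables (U : set (cspace R n)) (oU : open U).

Lemma csmooth_axis A f p : csmooth U f -> U p ->
  axis_derivation A p f (pderiv A f p).
Proof.
move=> /(_ 1%N)[[_ /(_ (delta_mx 0 A))[r _]] [_ /(_ (delta_mx 0 A))[i _]]] Up.
by split; split; [exact: r|by []|exact: i|by []].
Qed.

Lemma csmooth_axis2 A B f p : csmooth U f -> U p ->
  axis_derivation A p (pderiv B f) (pderiv A (pderiv B f) p).
Proof.
move=> /(_ 2%N)[[_ /(_ (delta_mx 0 B))[_ [_ r]]] [_ /(_ (delta_mx 0 B))[_ [_ i]]]] Up.
have [{}r _] := r (delta_mx 0 A); have [{}i _] := i (delta_mx 0 A).
by split; split; [exact: r|by []|exact: i|by []].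
Qed.

Lemma pderivC A B f p : csmooth U f -> U p ->
  pderiv A (pderiv B f) p = pderiv B (pderiv A f) p.
Proof.
move=> /(_ 2%N)[r i] Up; rewrite /pderiv /=.
by rewrite (Ck_open_schwarz _ _ oU r Up) (Ck_open_schwarz _ _ oU i Up).
Qed.

Lemma wirtinger_ex A f p :
  (forall B, axis_derivation B p f (pderiv B f p)) ->
  wirtinger A p f (wderiv A f p).
Proof. by move=> H; do 2!eexists; split; [exact: H|exact: H|rewrite wderivE]. Qed.

Lemma csmooth_wirtinger A f p : csmooth U f -> U p ->
  wirtinger A p f (wderiv A f p).
Proof. by move=> fs Up; apply: wirtinger_ex => B; exact: csmooth_axis. Qed.

Lemma csmooth_axis_wderiv A B f p : csmooth U f -> U p ->
  axis_derivation A p (wderiv B f)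
    (wcomb B (pderiv A (pderiv (hol n (axis B)) f) p)
             (pderiv A (pderiv (ahol n (axis B)) f) p)).
Proof.
move=> fs Up.
have H C := csmooth_axis2 A C fs Up.
rewrite (_ : wderiv B f = fun q => wcomb B (pderiv (hol n (axis B)) f q)
    (pderiv (ahol n (axis B)) f q)); last by apply/funext => q; rewrite wderivE.
rewrite /wcomb; case: (fintype.split B) => _.
  by apply: derMl; apply: derB => //; apply: derMl.
by apply: derMl; apply: derD => //; apply: derMl.
Qed.

Lemma csmooth_wirtinger2 A B f p : csmooth U f -> U p ->
  wirtinger A p (wderiv B f) (wderiv A (wderiv B f) p).
Proof.
move=> fs Up; apply: wirtinger_ex => C; have H := csmooth_axis_wderiv C B fs Up.
by rewrite (pderiv_eq H).
Qed.

Lemma wderivC A B f p : csmooth U f -> U p ->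
  wderiv A (wderiv B f) p = wderiv B (wderiv A f) p.
Proof.
move=> fs Up; rewrite !(wderivE _ (wderiv _ _)).
rewrite !(pderiv_eq (csmooth_axis_wderiv _ _ fs Up)).
rewrite (pderivC (hol n (axis B)) (hol n (axis A)) fs Up).
rewrite (pderivC (hol n (axis B)) (ahol n (axis A)) fs Up).
rewrite (pderivC (ahol n (axis B)) (hol n (axis A)) fs Up).
rewrite (pderivC (ahol n (axis B)) (ahol n (axis A)) fs Up).
exact: wcombC.
Qed.

End Smooth.
End Wirtinger.

(** * Curvature of the generalized metric *)

Section Adjoint.
Variable R : realType.
Local Notation C := R[i].

Lemma adjE m n (A : 'M[C]_(m, n)) : adj A = map_mx (@conjc R) A^T.
Proof. by apply/matrixP => i j; rewrite !mxE. Qed.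

Lemma adjM m n p (A : 'M[C]_(m, n)) (B : 'M[C]_(n, p)) :
  adj (A *m B) = adj B *m adj A.
Proof. by rewrite !adjE trmx_mul map_mxM. Qed.

Lemma adjD m n (A B : 'M[C]_(m, n)) : adj (A + B) = adj A + adj B.
Proof. by apply/matrixP => i j; rewrite !mxE rmorphD. Qed.

Lemma adjN m n (A : 'M[C]_(m, n)) : adj (- A) = - adj A.
Proof. by apply/matrixP => i j; rewrite !mxE rmorphN. Qed.

Lemma adjZ m n a (A : 'M[C]_(m, n)) : adj (a *: A) = a^*%C *: adj A.
Proof. by apply/matrixP => i j; rewrite !mxE rmorphM. Qed.

Lemma adj_sum m n (I : finType) (F : I -> 'M[C]_(m, n)) :
  adj (\sum_i F i) = \sum_i adj (F i).
Proof.
apply/matrixP => i j; rewrite mxE !summxE rmorph_sum /=.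
by apply: eq_bigr => k _; rewrite mxE.
Qed.

Lemma adj_tr m n (A : 'M[C]_(m, n)) : adj A^T = (adj A)^T.
Proof. by apply/matrixP => i j; rewrite !mxE. Qed.

Lemma adjV n (A : 'M[C]_n) : adj (invmx A) = invmx (adj A).
Proof. by rewrite !adjE trmx_inv map_invmx. Qed.

Lemma adj_mder_time (I : interval R) (t : R) m n (F : R -> 'M[C]_(m, n)) L :
  mder (complexify (interval_derivation I t)) F L ->
  mder (complexify (interval_derivation I t)) (fun s => adj (F s)) (adj L).
Proof.
move=> FL i j; apply: der_eq (complexify_conj (FL j i)) _ _ => [y|];
  by rewrite mxE.
Qed.

Lemma mder_adj_wirtinger l (A : 'I_(l + l)) (p : cspace R l) m n
    (F : cspace R l -> 'M[C]_(m, n)) L :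
  mder (wirtinger A p) F L ->
  mder (wirtinger (conj_idx A) p) (fun s => adj (F s)) (adj L).
Proof.
move=> FL i j; apply: der_eq (wirtinger_conj (FL j i)) _ _ => [y|];
  by rewrite mxE.
Qed.

End Adjoint.

(** * Block unipotent factors and their derivatives *)

Section Gauge.
Variables (K : fieldType) (n : nat).
Implicit Types b c : 'M[K]_n.

(** The two factors carry independent parameters because an abstract field has no conjugation; in
    the application the parameter of [lgauge] is the adjoint of b. *)
Definition ugauge b : 'M[K]_(n + n) := block_mx 1%:M b 0 1%:M.
Definition lgauge c : 'M[K]_(n + n) := block_mx 1%:M 0 c 1%:M.

Lemma ugaugeK b : ugauge (- b) *m ugauge b = 1%:M.
Proof.
rewrite mulmx_block !(mul1mx, mulmx1, mul0mx, mulmx0, addr0, add0r) subrr.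
by rewrite -scalar_mx_block.
Qed.

Lemma ugaugeNK b : ugauge b *m ugauge (- b) = 1%:M.
Proof. by rewrite -{1}[b]opprK ugaugeK. Qed.

Lemma lgaugeK c : lgauge c *m lgauge (- c) = 1%:M.
Proof.
rewrite mulmx_block !(mul1mx, mulmx1, mul0mx, mulmx0, addr0, add0r) subrr.
by rewrite -scalar_mx_block.
Qed.

Lemma gauge_block b c (g k : 'M[K]_n) :
  ugauge b *m block_mx g 0 0 k *m lgauge c =
  block_mx (g + b *m k *m c) (b *m k) (k *m c) k.
Proof.
rewrite !mulmx_block.
by rewrite !(mul1mx, mulmx1, mul0mx, mulmx0, addr0, add0r).
Qed.

Lemma gauge_congr b c (Y Z : 'M[K]_(n + n)) : Y = Z ->
  ugauge b *m Y *m lgauge c = ugauge b *m Z *m lgauge c.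
Proof. by move->. Qed.

Lemma block_mx_congr (A A' B B' C C' E E' : 'M[K]_n) :
  A = A' -> B = B' -> C = C' -> E = E' ->
  block_mx A B C E = block_mx A' B' C' E'.
Proof. by move=> -> -> -> ->. Qed.

Lemma gaugeB b c (Y Z : 'M[K]_(n + n)) :
  - (ugauge b *m Y *m lgauge c) + ugauge b *m Z *m lgauge c =
  ugauge b *m (- Y + Z) *m lgauge c.
Proof. by rewrite mulmxDr mulmxN mulmxDl mulNmx. Qed.

(** The derivative of [ugauge b] is a nilpotent block that [ugauge b] fixes from the left, and
    likewise for [lgauge c] from the right. The outer factors therefore survive differentiation and
    only the middle one changes, so the lemma can be iterated. *)
Lemma mder_gauge (X : Type) (x : X) (D : derivation_at K x)
    (b c F11 F12 F21 F22 : X -> 'M[K]_n) (b' c' L11 L12 L21 L22 : 'M[K]_n) :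
  mder D b b' -> mder D c c' -> mder D F11 L11 -> mder D F12 L12 ->
  mder D F21 L21 -> mder D F22 L22 ->
  mder D (fun y => ugauge (b y) *m block_mx (F11 y) (F12 y) (F21 y) (F22 y)
                   *m lgauge (c y))
   (ugauge (b x) *m
     block_mx (L11 + b' *m F21 x + F12 x *m c') (L12 + b' *m F22 x)
              (L21 + F22 x *m c') L22 *m lgauge (c x)).
Proof.
move=> Db Dc D11 D12 D21 D22.
have Du : mder D (fun y => ugauge (b y)) (block_mx 0 b' 0 0).
  by apply: mder_block => //; exact: mder_cst.
have Dl : mder D (fun y => lgauge (c y)) (block_mx 0 0 c' 0).
  by apply: mder_block => //; exact: mder_cst.
apply: mder_eq (mderM (mderM Du (mder_block D11 D12 D21 D22)) Dl) _ _ => //.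
have -> : block_mx 0 b' 0 0 =
    ugauge (b x) *m (block_mx 0 b' 0 0 : 'M[K]_(n + n)).
  by rewrite mulmx_block !(mul1mx, mul0mx, mulmx0, addr0).
have -> : block_mx 0 0 c' 0 =
    (block_mx 0 0 c' 0 : 'M[K]_(n + n)) *m lgauge (c x).
  by rewrite mulmx_block !(mulmx1, mul0mx, mulmx0, addr0, add0r).
rewrite mulmxA -!mulmxA -!mulmxDr !mulmxA -!mulmxDl -!mulmxA -!mulmxDr !mulmxA.
congr (_ *m _ *m _).
rewrite !mulmx_block !add_block_mx !(mul0mx, mulmx0, addr0, add0r).
by rewrite (addrC _ L11) (addrC _ L12).
Qed.

(** In the quadratic term of the curvature the gauge factors of the two first derivatives surround
    the inverse of G in exactly this way. *)
Lemma invmx_gauge b c (g : 'M[K]_n) : g \in unitmx ->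
  lgauge c *m invmx (ugauge b *m block_mx g 0 0 (invmx g)^T *m lgauge c)
    *m ugauge b = block_mx (invmx g) 0 0 g^T.
Proof.
move=> gu; set G := _ *m lgauge c.
pose H := lgauge (- c) *m block_mx (invmx g) 0 0 g^T *m ugauge (- b).
have GH : G *m H = 1%:M.
  rewrite /G /H !mulmxA -[_ *m lgauge c *m _]mulmxA lgaugeK mulmx1.
  rewrite -[ugauge b *m _ *m _]mulmxA mulmx_block.
  rewrite !(mul0mx, mulmx0, addr0, add0r) mulmxV // -trmx_mul mulmxV // trmx1.
  by rewrite -scalar_mx_block mulmx1 ugaugeNK.
have [Gu _] := mulmx1_unit GH.
have -> : invmx G = H by rewrite -[LHS]mulmx1 -GH mulKmx.
rewrite /H !mulmxA lgaugeK mul1mx -mulmxA ugaugeK mulmx1 //.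
Qed.

(* The Chern curvature of [diag (g, k)], [k] the dual metric, in a frame where
   [b] vanishes at the point; [GA], [BA] are first and [GCA], [BCA] second
   derivatives, and [XA] stands for the derivative of [b^*]. *)
Lemma curvature_blocks (g h k gT GA GC GCA GAT GCT GCAT BA BC BCA XA XC XCA
    : 'M[K]_n) :
  g *m h = 1%:M -> k *m gT = 1%:M ->
  let kA := - (k *m GAT *m k) in let kC := - (k *m GCT *m k) in
  - block_mx (GCA + BC *m (k *m XA) + BA *m k *m XC)
             (BCA *m k + BA *m kC + BC *m kA)
             (kC *m XA + k *m XCA + kA *m XC)
             (- ((kC *m GAT + k *m GCAT) *m k + k *m GAT *m kC))
  + block_mx GC (BC *m k) (k *m XC) kC *m block_mx h 0 0 gT
    *m block_mx GA (BA *m k) (k *m XA) kA =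
  block_mx (- GCA + GC *m h *m GA - BA *m k *m XC)
           ((- BCA + GC *m h *m BA + BA *m k *m GCT) *m k)
           (k *m (- XCA + XC *m h *m GA + GAT *m k *m XC))
           (k *m (GCAT - GAT *m k *m GCT + XC *m h *m BA) *m k).
Proof.
move=> gh kg /=.
rewrite opp_block_mx !mulmx_block !(mulmx0, addr0, add0r) add_block_mx.
rewrite !(mulmxDl, mulmxDr, mulNmx, mulmxN, mulmxA).
have kgk (Z : 'M[K]_n) : Z *m k *m gT = Z by rewrite -mulmxA kg mulmx1.
rewrite !kgk; congr block_mx; apply/matrixP => i j.
(* Only sums and signs are evaluated entrywise; the matrix products remain atoms for [ring]. *)
- have addE (Y Z : 'M[K]_n) : (Y + Z) i j = Y i j + Z i j by rewrite mxE.
  have oppE (Z : 'M[K]_n) : (- Z) i j = - Z i j by rewrite mxE.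
  by rewrite !(addE, oppE); ring.
- have addE (Y Z : 'M[K]_n) : (Y + Z) i j = Y i j + Z i j by rewrite mxE.
  have oppE (Z : 'M[K]_n) : (- Z) i j = - Z i j by rewrite mxE.
  by rewrite !(addE, oppE); ring.
- have addE (Y Z : 'M[K]_n) : (Y + Z) i j = Y i j + Z i j by rewrite mxE.
  have oppE (Z : 'M[K]_n) : (- Z) i j = - Z i j by rewrite mxE.
  by rewrite !(addE, oppE); ring.
- have addE (Y Z : 'M[K]_n) : (Y + Z) i j = Y i j + Z i j by rewrite mxE.
  have oppE (Z : 'M[K]_n) : (- Z) i j = - Z i j by rewrite mxE.
  by rewrite !(addE, oppE); ring.
Qed.

End Gauge.

(** * Chern curvature of the generalized metric in a chart *)

Section MatrixWirtinger.
Variables (R : realType) (n : nat).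
Implicit Types (p q : cspace R n) (A B : 'I_(n + n)).

Definition wderiv_mx m k (A : 'I_(n + n)) (F : cspace R n -> 'M[R[i]]_(m, k))
    (p : cspace R n) : 'M[R[i]]_(m, k) :=
  \matrix_(i, j) wderiv A (fun q => F q i j) p.

Lemma wderiv_mx_eq m k A (F : cspace R n -> 'M[R[i]]_(m, k)) p L :
  mder (wirtinger A p) F L -> wderiv_mx A F p = L.
Proof. by move=> FL; apply/matrixP => i j; rewrite mxE (wderiv_eq (FL i j)). Qed.

Lemma wderiv_mx_mwE m k A B (F : cspace R n -> 'M[R[i]]_(m, k)) p i j :
  wderiv_mx A (wderiv_mx B F) p i j = wderiv A (wderiv B (fun q => F q i j)) p.
Proof.
rewrite mxE; apply: (congr1 (fun f => wderiv A f p)).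
by apply/funext => q; rewrite mxE.
Qed.

Lemma chern_curv_mx m (G : cspace R n -> 'M[R[i]]_m) i j p :
  \matrix_(A, B) chern_curv G i j A B p =
  - wderiv_mx (hol n i) (wderiv_mx (ahol n j) G) p
  + wderiv_mx (hol n i) G p *m invmx (G p) *m wderiv_mx (ahol n j) G p.
Proof.
apply/matrixP => A B; rewrite mxE [RHS]mxE [in RHS]mxE wderiv_mx_mwE; congr (_ + _).
rewrite mxE exchange_big; apply: eq_bigr => D _.
by rewrite mxE big_distrl; apply: eq_bigr => C _; rewrite !mxE.
Qed.

Variables (U : set (cspace R n)) (oU : open U).

Lemma smooth_mder m k A (F : cspace R n -> 'M[R[i]]_(m, k)) p :
  (forall i j, csmooth U (fun q => F q i j)) -> U p ->
  mder (wirtinger A p) F (wderiv_mx A F p).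
Proof. by move=> Fs Up i j; rewrite mxE; exact: csmooth_wirtinger. Qed.

Lemma smooth_mder2 m k A B (F : cspace R n -> 'M[R[i]]_(m, k)) p :
  (forall i j, csmooth U (fun q => F q i j)) -> U p ->
  mder (wirtinger A p) (wderiv_mx B F) (wderiv_mx A (wderiv_mx B F) p).
Proof.
move=> Fs Up i j.
apply: der_eq (csmooth_wirtinger2 A B (Fs i j) Up) _ _ => [q|].
  by rewrite mxE.
by rewrite -wderiv_mx_mwE.
Qed.

Lemma wderiv_mxC m k A B (F : cspace R n -> 'M[R[i]]_(m, k)) p :
  (forall i j, csmooth U (fun q => F q i j)) -> U p ->
  wderiv_mx A (wderiv_mx B F) p = wderiv_mx B (wderiv_mx A F) p.
Proof.
by move=> Fs Up; apply/matrixP => i j; rewrite !wderiv_mx_mwE (wderivC oU).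
Qed.

Lemma near_open p (P : set (cspace R n)) : U p -> (forall q, U q -> P q) ->
  nbhs p P.
Proof.
by move=> Up UP; apply: filterS (open_nbhs_nbhs (conj oU Up)) => q; exact: UP.
Qed.

Variables (g b : Defs.mfun R n).
Hypothesis gs : forall i j, csmooth U (fun q => g q i j).
Hypothesis bs : forall i j, csmooth U (fun q => b q i j).
Hypothesis gu : forall q, U q -> g q \in unitmx.

Let h q := invmx (g q).
Let k q := (invmx (g q))^T.

Lemma mder_invmx A p : U p ->
  mder (wirtinger A p) h (- (h p *m wderiv_mx A g p *m h p)).
Proof.
by move=> Up; apply: mderV; [exact: near_open|exact: gu|exact: smooth_mder].
Qed.

Lemma mder_dual A p : U p ->
  mder (wirtinger A p) k (- (k p *m (wderiv_mx A g p)^T *m k p)).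
Proof.
move=> Up; have := mder_tr (mder_invmx A Up).
by rewrite raddfN /= !trmx_mul mulmxA.
Qed.

Lemma gen_metricE q : gen_metric g b q =
  ugauge (b q) *m block_mx (g q) 0 0 (k q) *m lgauge (adj (b q)).
Proof.
rewrite gauge_block /gen_metric; congr block_mx; apply/matrixP => i j.
- rewrite !mxE; congr (_ + _); rewrite exchange_big; apply: eq_bigr => l _.
  rewrite mxE big_distrl; apply: eq_bigr => m _ /=.
  by rewrite /k /h !mxE; ring.
- by rewrite !mxE; apply: eq_bigr => m _; rewrite /k !mxE mulrC.
- by rewrite !mxE; apply: eq_bigr => m _; rewrite /k !mxE.
- by rewrite /k !mxE.
Qed.

(** The middle factor of the first derivative of G. The derivative of the adjoint of b along A is
    the adjoint of the derivative of b along the conjugate vector, whence [conj_idx] in the lower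
    left block. *)
Definition gauged_deriv A q : 'M[R[i]]_(n + n) :=
  block_mx (wderiv_mx A g q) (wderiv_mx A b q *m k q)
           (k q *m adj (wderiv_mx (conj_idx A) b q))
           (- (k q *m (wderiv_mx A g q)^T *m k q)).

Lemma conj_idxK A : conj_idx (conj_idx A) = A.
Proof. by case: (split_ordP A) => i ->; rewrite ?(conj_idx_hol, conj_idx_ahol). Qed.

Lemma mder_adj A (F : Defs.mfun R n) L p : mder (wirtinger (conj_idx A) p) F L ->
  mder (wirtinger A p) (fun q => adj (F q)) (adj L).
Proof. by move=> /mder_adj_wirtinger; rewrite conj_idxK. Qed.

Lemma wderiv_mx_gen_metric A q : U q -> wderiv_mx A (gen_metric g b) q =
  ugauge (b q) *m gauged_deriv A q *m lgauge (adj (b q)).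
Proof.
move=> Uq; apply: wderiv_mx_eq; have H := mder_gauge (smooth_mder A bs Uq)
  (mder_adj (smooth_mder (conj_idx A) bs Uq)) (smooth_mder A gs Uq)
  (mder_cst _ 0) (mder_cst _ 0) (mder_dual A Uq).
apply: mder_eq H _ _ => [q'|]; first by rewrite gen_metricE.
by rewrite !(mul0mx, mulmx0, addr0, add0r).
Qed.

Lemma mder_wderiv_mx_gen_metric A C p L : U p ->
  mder (wirtinger C p)
    (fun q => ugauge (b q) *m gauged_deriv A q *m lgauge (adj (b q))) L ->
  mder (wirtinger C p) (wderiv_mx A (gen_metric g b)) L.
Proof.
move=> Up; apply: mder_germ; last by rewrite wderiv_mx_gen_metric.
have UE q : U q -> ugauge (b q) *m gauged_deriv A q *m lgauge (adj (b q)) =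
  wderiv_mx A (gen_metric g b) q by move=> Uq; rewrite wderiv_mx_gen_metric.
exact: near_open Up UE.
Qed.

(** A second use of [mder_gauge], now on [gauged_deriv], gives the second derivative of G with the
    same outer factors. By [invmx_gauge] the quadratic term has them too, so the curvature reduces
    to [curvature_blocks]. *)
Lemma chern_gen_metric i j p : U p ->
  let C := hol n i in let A := ahol n j in
  let C' := ahol n i in let A' := hol n j in
  \matrix_(D, B) chern_curv (gen_metric g b) i j D B p =
  ugauge (b p) *m block_mx
    (- wderiv_mx C (wderiv_mx A g) p + wderiv_mx C g p *m h p *m wderiv_mx A g p
      - wderiv_mx A b p *m k p *m adj (wderiv_mx C' b p))
    ((- wderiv_mx C (wderiv_mx A b) p + wderiv_mx C g p *m h p *m wderiv_mx A b p
      + wderiv_mx A b p *m k p *m (wderiv_mx C g p)^T) *m k p)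
    (k p *m (- adj (wderiv_mx C' (wderiv_mx A' b) p)
      + adj (wderiv_mx C' b p) *m h p *m wderiv_mx A g p
      + (wderiv_mx A g p)^T *m k p *m adj (wderiv_mx C' b p)))
    (k p *m ((wderiv_mx C (wderiv_mx A g) p)^T
      - (wderiv_mx A g p)^T *m k p *m (wderiv_mx C g p)^T
      + adj (wderiv_mx C' b p) *m h p *m wderiv_mx A b p) *m k p)
  *m lgauge (adj (b p)).
Proof.
move=> Up C A C' A'; have gp := gu Up.
have cC : conj_idx C = C' by exact: conj_idx_hol.
have cA : conj_idx A = A' by exact: conj_idx_ahol.
rewrite chern_curv_mx -/C -/A.
have Dk := mder_dual C Up.
have DgA := smooth_mder2 C A gs Up.
have D12 := mderM (smooth_mder2 C A bs Up) Dk.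
have D21 := mderM Dk (mder_adj (smooth_mder2 (conj_idx C) (conj_idx A) bs Up)).
have D22 := mderN (mderM (mderM Dk (mder_tr DgA)) Dk).
have D := mder_gauge (smooth_mder C bs Up)
  (mder_adj (smooth_mder (conj_idx C) bs Up)) DgA D12 D21 D22.
have {}D := mder_wderiv_mx_gen_metric Up D.
rewrite (wderiv_mx_eq D) !wderiv_mx_gen_metric // gen_metricE.
have Hinv := invmx_gauge (b p) (adj (b p)) gp.
set G := ugauge _ *m block_mx (g p) _ _ _ *m _ in Hinv *.
have assoc (u x l Gi y : 'M[R[i]]_(n + n)) :
    u *m x *m l *m Gi *m (u *m y *m l) = u *m (x *m (l *m Gi *m u) *m y) *m l.
  by rewrite !mulmxA.
rewrite assoc Hinv.
rewrite gaugeB; apply: gauge_congr.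
rewrite /gauged_deriv cC cA.
apply: curvature_blocks; first exact: mulmxV.
by rewrite -trmx_mul mulmxV // trmx1.
Qed.

End MatrixWirtinger.

(** * The Bismut connection *)

Lemma sqr_imaginary (R : realType) : ('i : R[i]) * 'i = -1.
Proof. by rewrite -expr2 sqrCi. Qed.

Lemma is_hol_hol n (i : 'I_n) : is_hol (hol n i).
Proof. by rewrite /is_hol /=. Qed.

Lemma is_hol_ahol n (i : 'I_n) : is_hol (ahol n i) = false.
Proof. by rewrite /is_hol /= ltnNge leq_addr. Qed.

Section ExteriorDerivative.
Variables (R : realType) (n : nat).

Lemma tdel3 (A B C : 'I_(n + n)) :
  [/\ tdel [tuple A; B; C] ord0 = [tuple B; C],
      tdel [tuple A; B; C] (lift ord0 ord0) = [tuple A; C] &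
      tdel [tuple A; B; C] (lift ord0 (lift ord0 ord0)) = [tuple A; B]].
Proof.
by split; apply: eq_from_tnth => -[[|[|//]] i]; rewrite tnth_mktuple !(tnth_nth A).
Qed.

Lemma del_2form (a : Defs.form R n 2) A B C p :
  del a [tuple A; B; C] p =
  (if is_hol A then wderiv A (a [tuple B; C]) p else 0)
  - (if is_hol B then wderiv B (a [tuple A; C]) p else 0)
  + (if is_hol C then wderiv C (a [tuple A; B]) p else 0).
Proof.
rewrite /del big_mkcond !big_ord_recl big_ord0 /=.
have [-> -> ->] := tdel3 A B C; rewrite !(tnth_nth A) /=.
move: (wderiv A _ _) (wderiv B _ _) (wderiv C _ _) => x y z.
by case: (is_hol A); case: (is_hol B); case: (is_hol C); rewrite /=; ring.
Qed.

Lemma delbar_2form (a : Defs.form R n 2) A B C p :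
  delbar a [tuple A; B; C] p =
  (if ~~ is_hol A then wderiv A (a [tuple B; C]) p else 0)
  - (if ~~ is_hol B then wderiv B (a [tuple A; C]) p else 0)
  + (if ~~ is_hol C then wderiv C (a [tuple A; B]) p else 0).
Proof.
rewrite /delbar big_mkcond !big_ord_recl big_ord0 /=.
have [-> -> ->] := tdel3 A B C; rewrite !(tnth_nth A) /=.
move: (wderiv A _ _) (wderiv B _ _) (wderiv C _ _) => x y z.
by case: (is_hol A); case: (is_hol B); case: (is_hol C); rewrite /=; ring.
Qed.

End ExteriorDerivative.

(** * Coefficients and Ricci form of the Bismut connection *)

Section Bismut.
Variables (R : realType) (n : nat) (U : set (cspace R n)) (oU : open U).
Variable g : Defs.mfun R n.
Hypothesis gs : forall i j, csmooth U (fun q => g q i j).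
Hypothesis gu : forall q, U q -> g q \in unitmx.

Let h q := invmx (g q).

Lemma riem_hh q i j : riem g q (hol n i) (hol n j) = 0.
Proof. by rewrite /riem block_mxEul mxE. Qed.

Lemma riem_ha q i j : riem g q (hol n i) (ahol n j) = g q i j.
Proof. by rewrite /riem block_mxEur. Qed.

Lemma riem_ah q i j : riem g q (ahol n i) (hol n j) = g q j i.
Proof. by rewrite /riem block_mxEdl mxE. Qed.

Lemma riem_aa q i j : riem g q (ahol n i) (ahol n j) = 0.
Proof. by rewrite /riem block_mxEdr mxE. Qed.

Lemma wderiv0 A (p : cspace R n) : wderiv A (fun=> 0) p = 0.
Proof. by apply: wderiv_eq; exact: der_cst. Qed.

Definition riem_wderiv A B C (p : cspace R n) := wderiv A (fun q => riem g q B C) p.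

Lemma riem_wderiv_hh A i j p : riem_wderiv A (hol n i) (hol n j) p = 0.
Proof.
by rewrite /riem_wderiv; under eq_fun do rewrite riem_hh; rewrite wderiv0.
Qed.

Lemma riem_wderiv_aa A i j p : riem_wderiv A (ahol n i) (ahol n j) p = 0.
Proof.
by rewrite /riem_wderiv; under eq_fun do rewrite riem_aa; rewrite wderiv0.
Qed.

Lemma riem_wderiv_ha A i j p :
  riem_wderiv A (hol n i) (ahol n j) p = wderiv_mx A g p i j.
Proof. by rewrite /riem_wderiv mxE; under eq_fun do rewrite riem_ha. Qed.

Lemma riem_wderiv_ah A i j p :
  riem_wderiv A (ahol n i) (hol n j) p = wderiv_mx A g p j i.
Proof. by rewrite /riem_wderiv mxE; under eq_fun do rewrite riem_ah. Qed.

Definition jsign (A : 'I_(n + n)) : R[i] := if is_hol A then 'i else - 'i.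

Lemma kahler_formE A B :
  kahler_form g [tuple A; B] = fun q => jsign A * riem g q A B.
Proof. by apply/funext => q; rewrite /kahler_form !(tnth_nth A). Qed.

Lemma wirtinger_riem A B C p : U p ->
  wirtinger A p (fun q => riem g q B C) (riem_wderiv A B C p).
Proof.
move=> Up; case: (split_ordP B) => i ->; case: (split_ordP C) => j ->.
- rewrite riem_wderiv_hh; apply: der_eq (der_cst _ 0) _ _ => // q; exact/esym/riem_hh.
- rewrite riem_wderiv_ha; apply: der_eq (smooth_mder A gs Up i j) _ _ => // q.
  exact/esym/riem_ha.
- rewrite riem_wderiv_ah; apply: der_eq (smooth_mder A gs Up j i) _ _ => // q.
  exact/esym/riem_ah.
- rewrite riem_wderiv_aa; apply: der_eq (der_cst _ 0) _ _ => // q; exact/esym/riem_aa.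
Qed.

Lemma wderiv_kahler A B C p : U p ->
  wderiv A (kahler_form g [tuple B; C]) p = jsign B * riem_wderiv A B C p.
Proof.
by move=> Up; rewrite kahler_formE; apply/wderiv_eq/derMl/wirtinger_riem.
Qed.

(** The coefficients with the last index lowered, g(nabla_A d_B, d_C): no inverse metric occurs in
    them, so each type of indices can be computed linearly in the derivatives of g. *)
Definition lowered_bismut A B C p : R[i] :=
  2^-1 * (riem_wderiv A B C p + riem_wderiv B A C p - riem_wderiv C A B p)
  + 2^-1 * torsionH g [tuple A; B; C] p.

Lemma bismut_lowered A B C p :
  bismut g A B C p = \sum_D lowered_bismut A B D p * invmx (riem g p) D C.
Proof.
rewrite /bismut /levi_civita -big_split; apply: eq_bigr => D _ /=.
by rewrite -mulrDl.
Qed.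

Lemma torsionHE A B C p : U p ->
  torsionH g [tuple A; B; C] p =
  'i * ((if is_hol A then 1 else -1) * (jsign B * riem_wderiv A B C p)
  - (if is_hol B then 1 else -1) * (jsign A * riem_wderiv B A C p)
  + (if is_hol C then 1 else -1) * (jsign A * riem_wderiv C A B p)).
Proof.
move=> Up; rewrite /torsionH del_2form delbar_2form !wderiv_kahler //.
move: (jsign B * riem_wderiv A B C p) (jsign A * riem_wderiv B A C p)
  (jsign A * riem_wderiv C A B p).
move=> x y z; congr (_ * _).
by case: (is_hol A); case: (is_hol B); case: (is_hol C); rewrite /=; ring.
Qed.

Lemma lowered_bismut_hhh a b d p : U p ->
  lowered_bismut (hol n a) (hol n b) (hol n d) p = 0.
Proof.
by move=> Up; rewrite /lowered_bismut torsionHE // !riem_wderiv_hh; ring.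
Qed.

(** The torsion exchanges a and b: the Chern connection would have the derivative of g_(b dbar)
    along a. *)
Lemma lowered_bismut_hha a b d p : U p ->
  lowered_bismut (hol n a) (hol n b) (ahol n d) p = wderiv_mx (hol n b) g p a d.
Proof.
move=> Up; rewrite /lowered_bismut torsionHE //.
rewrite !(riem_wderiv_hh, riem_wderiv_ha, riem_wderiv_ah).
rewrite /jsign !is_hol_hol is_hol_ahol.
move: (wderiv_mx _ g p b d) (wderiv_mx _ g p a d) => x y.
(* The two factors i, one from d^c and one from the Kähler form, are collected so that their product
   can be replaced by -1. *)
have E : 'i * (1 * ('i * x) - 1 * ('i * y) + -1 * ('i * 0)) = 'i * 'i * (x - y) :> R[i].
  by ring.
by rewrite E sqr_imaginary; field.
Qed.

Lemma lowered_bismut_ahh a b d p : U p ->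
  lowered_bismut (ahol n a) (hol n b) (hol n d) p = 0.
Proof.
move=> Up; rewrite /lowered_bismut torsionHE //.
rewrite !(riem_wderiv_hh, riem_wderiv_ha, riem_wderiv_ah).
rewrite /jsign !is_hol_hol is_hol_ahol.
move: (wderiv_mx _ g p b a) (wderiv_mx _ g p d a) => x y.
have E : 'i * (-1 * ('i * 0) - 1 * (- 'i * y) + 1 * (- 'i * x))
  = 'i * 'i * (y - x) :> R[i] by ring.
by rewrite E sqr_imaginary; ring.
Qed.

(** Levi-Civita and H contribute equal halves. For the Chern connection this coefficient is zero. *)
Lemma lowered_bismut_aha a b d p : U p ->
  lowered_bismut (ahol n a) (hol n b) (ahol n d) p =
  wderiv_mx (ahol n a) g p b d - wderiv_mx (ahol n d) g p b a.
Proof.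
move=> Up; rewrite /lowered_bismut torsionHE //.
rewrite !(riem_wderiv_aa, riem_wderiv_ha, riem_wderiv_ah).
rewrite /jsign !is_hol_hol !is_hol_ahol.
move: (wderiv_mx _ g p b d) (wderiv_mx _ g p b a) => x y.
have E : 'i * (-1 * ('i * x) - 1 * (- 'i * 0) + -1 * (- 'i * y))
  = 'i * 'i * (y - x) :> R[i] by ring.
by rewrite E sqr_imaginary; field.
Qed.

Lemma invmx_riem q : U q -> invmx (riem g q) = block_mx 0 (h q)^T (h q) 0.
Proof.
move=> Uq; have E : riem g q *m block_mx 0 (h q)^T (h q) 0 = 1%:M.
  rewrite mulmx_block !(mul0mx, mulmx0, addr0, add0r) mulmxV ?gu //.
  by rewrite -trmx_mul mulVmx ?gu // trmx1 -scalar_mx_block.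
have [ru _] := mulmx1_unit E.
by rewrite -[LHS]mulmx1 -E mulKmx.
Qed.

Lemma bismut_hh a b c q : U q ->
  bismut g (hol n a) (hol n b) (hol n c) q =
  \sum_d wderiv_mx (hol n b) g q a d * h q d c.
Proof.
move=> Uq; rewrite bismut_lowered big_split_ord /= invmx_riem //.
rewrite big1 ?add0r => [|d _]; last by rewrite lowered_bismut_hhh // mul0r.
by apply: eq_bigr => d _; rewrite lowered_bismut_hha // block_mxEdl.
Qed.

Lemma bismut_ah a b c q : U q ->
  bismut g (ahol n a) (hol n b) (hol n c) q =
  \sum_d (wderiv_mx (ahol n a) g q b d - wderiv_mx (ahol n d) g q b a) * h q d c.
Proof.
move=> Uq; rewrite bismut_lowered big_split_ord /= invmx_riem //.
rewrite big1 ?add0r => [|d _]; last by rewrite lowered_bismut_ahh // mul0r.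
by apply: eq_bigr => d _; rewrite lowered_bismut_aha // block_mxEdl.
Qed.

(* The Bismut connection preserves [T^(1,0)]. *)
Lemma bismut_h_ahol A b c q : U q -> bismut g A (hol n b) (ahol n c) q = 0.
Proof.
move=> Uq; rewrite bismut_lowered big_split_ord /= invmx_riem //.
rewrite !big1 ?addr0 // => d _.
  by rewrite block_mxEdr mxE mulr0.
by case: (split_ordP A) => a ->;
  rewrite ?lowered_bismut_hhh ?lowered_bismut_ahh // mul0r.
Qed.

(** Once the antiholomorphic intermediate index drops out, the quadratic terms form the trace of a
    commutator of endomorphisms of T^(1,0), which is zero. *)
Lemma bismut_ricciE A B p : U p ->
  bismut_ricci g [tuple A; B] p =
  'i * \sum_k (wderiv A (bismut g B (hol n k) (hol n k)) p
             - wderiv B (bismut g A (hol n k) (hol n k)) p).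
Proof.
move=> Up; rewrite /bismut_ricci !(tnth_nth A) /= /bismut_curv big_split /=.
congr (_ * _); rewrite -[RHS]addr0; congr (_ + _).
have zero (x y u v : R[i]) : x = 0 -> y = 0 -> x * u - y * v = 0.
  by move=> -> ->; rewrite !mul0r subrr.
transitivity (\sum_(k < n) \sum_(f < n)
    (bismut g B (hol n k) (hol n f) p * bismut g A (hol n f) (hol n k) p
     - bismut g A (hol n k) (hol n f) p * bismut g B (hol n f) (hol n k) p)).
  apply: eq_bigr => k _; rewrite big_split_ord /= [X in _ + X]big1 ?addr0 //.
  by move=> f _; apply: zero; exact: bismut_h_ahol.
under eq_bigr do rewrite sumrB; rewrite sumrB [X in _ - X]exchange_big /=.
apply/eqP; rewrite subr_eq0; apply/eqP.
by apply: eq_bigr => k _; apply: eq_bigr => f _; rewrite mulrC.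
Qed.

Let dh A p := - (h p *m wderiv_mx A g p *m h p).

Lemma wderiv_bismut_hh A a b c p : U p ->
  wderiv A (bismut g (hol n a) (hol n b) (hol n c)) p =
  \sum_d (wderiv_mx A (wderiv_mx (hol n b) g) p a d * h p d c
          + wderiv_mx (hol n b) g p a d * dh A p d c).
Proof.
move=> Up; apply: wderiv_eq.
have H d := derM (smooth_mder2 A (hol n b) gs Up a d) (mder_invmx oU gs gu A Up d c).
apply: der_germ (der_sum (index_enum _) xpredT H).
  by apply: near_open oU _ _ Up _ => q Uq /=; rewrite bismut_hh.
by rewrite bismut_hh.
Qed.

Lemma wderiv_bismut_ah A a b c p : U p ->
  wderiv A (bismut g (ahol n a) (hol n b) (hol n c)) p =
  \sum_d ((wderiv_mx A (wderiv_mx (ahol n a) g) p b d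
            - wderiv_mx A (wderiv_mx (ahol n d) g) p b a) * h p d c
     + (wderiv_mx (ahol n a) g p b d - wderiv_mx (ahol n d) g p b a) * dh A p d c).
Proof.
move=> Up; apply: wderiv_eq.
have H d := derM (derB (smooth_mder2 A (ahol n a) gs Up b d)
  (smooth_mder2 A (ahol n d) gs Up b a)) (mder_invmx oU gs gu A Up d c).
apply: der_germ (der_sum (index_enum _) xpredT H).
  by apply: near_open oU _ _ Up _ => q Uq /=; rewrite bismut_ah.
by rewrite bismut_ah.
Qed.

End Bismut.

(** * Trace identities for the Ricci form *)

Section TraceIdentities.
(** Stand-ins at a point for the inverse metric, the imaginary unit and the first and second
    derivatives of g: what is left to prove is algebra over a field. *)
Variables (K : fieldType) (n : nat) (h : 'M[K]_n) (I : K).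
Variables (G1 : 'I_(n + n) -> 'M[K]_n) (G2 : 'I_(n + n) -> 'I_(n + n) -> 'M[K]_n).
Hypothesis G2C : forall A B, G2 A B = G2 B A.

Definition contract2 (F : 'I_n -> 'I_n -> K) := \sum_i \sum_j h j i * F i j.

Definition contract4 (F : 'I_n -> 'I_n -> 'I_n -> 'I_n -> K) :=
  \sum_i \sum_j \sum_m \sum_l h j i * h l m * F i j m l.

Lemma eq_contract2 F F' : (forall i j, F i j = F' i j) ->
  contract2 F = contract2 F'.
Proof. by move=> E; do 2!apply: eq_bigr => ? _; rewrite E. Qed.

Lemma contract2D F F' :
  contract2 (fun i j => F i j + F' i j) = contract2 F + contract2 F'.
Proof.
rewrite -big_split; apply: eq_bigr => i _; rewrite -big_split.
by apply: eq_bigr => j _; rewrite /= mulrDr.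
Qed.

Lemma contract2Z a F : contract2 (fun i j => a * F i j) = a * contract2 F.
Proof.
rewrite big_distrr; apply: eq_bigr => i _; rewrite big_distrr.
by apply: eq_bigr => j _; rewrite /= mulrCA.
Qed.

Lemma eq_contract4 F F' : (forall i j m l, F i j m l = F' i j m l) ->
  contract4 F = contract4 F'.
Proof. by move=> E; do 4!apply: eq_bigr => ? _; rewrite E. Qed.

Lemma contract4D F F' :
  contract4 (fun i j m l => F i j m l + F' i j m l) = contract4 F + contract4 F'.
Proof.
do 4!(rewrite -big_split; apply: eq_bigr => ? _).
by rewrite /= mulrDr.
Qed.

Lemma contract4Z a F : contract4 (fun i j m l => a * F i j m l) = a * contract4 F.
Proof.
do 4!(rewrite big_distrr; apply: eq_bigr => ? _).
by rewrite /= mulrCA.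
Qed.

(** The two copies of the inverse metric are interchangeable; the trace identities match quadratic
    terms through this symmetry. *)
Lemma contract4_swap F : contract4 F = contract4 (fun i j m l => F m l i j).
Proof.
have pairE F' : contract4 F' = \sum_(x : 'I_n * 'I_n) \sum_(y : 'I_n * 'I_n)
    h x.2 x.1 * h y.2 y.1 * F' x.1 x.2 y.1 y.2.
  rewrite /contract4 pair_big /=; apply: eq_bigr => x _.
  by rewrite pair_big.
rewrite !pairE exchange_big; apply: eq_bigr => x _; apply: eq_bigr => y _.
by rewrite [h y.2 _ * _]mulrC.
Qed.

Lemma contract2_mulmx (A B : 'I_n -> 'M[K]_n) a c :
  contract2 (fun i j => (A i *m h *m B j) a c) =
  contract4 (fun i j m l => A i a l * B j m c).
Proof.
do 2!apply: eq_bigr => ? _; rewrite mxE big_distrr; apply: eq_bigr => m _.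
rewrite mxE !big_distrl big_distrr; apply: eq_bigr => l _ /=.
by ring.
Qed.

Lemma contract2_mulmxT (A B : 'I_n -> 'I_n -> 'M[K]_n) a c :
  contract2 (fun i j => (B i j *m h^T *m A i j) a c) =
  contract4 (fun i j m l => B i j a m * A i j l c).
Proof.
do 2!apply: eq_bigr => ? _; rewrite mxE exchange_big big_distrr.
apply: eq_bigr => l _; rewrite mxE !big_distrl big_distrr.
by apply: eq_bigr => m _ /=; rewrite !mxE; ring.
Qed.

(** Brings the terms of the Ricci form in which the inverse metric is differentiated to the same
    normal form as the quadratic terms of the curvature. *)
Lemma contract_dinv (X : 'I_n -> 'I_n -> K) (A : 'M[K]_n) :
  \sum_k \sum_d X k d * (- (h *m A *m h)) d k =
  - contract4 (fun i j m l => X i l * A m j).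
Proof.
rewrite /contract4 -sumrN; apply: eq_bigr => i _.
transitivity (\sum_l \sum_j \sum_m - (h j i * h l m * (X i l * A m j))).
  apply: eq_bigr => l _; rewrite 2!mxE -sumrN big_distrr.
  apply: eq_bigr => j _; rewrite mxE big_distrl -sumrN big_distrr.
  by apply: eq_bigr => m _ /=; ring.
rewrite exchange_big -sumrN; apply: eq_bigr => j _.
rewrite exchange_big -sumrN; apply: eq_bigr => m _.
by rewrite sumrN.
Qed.

Let dh A := - (h *m G1 A *m h).

(** After the torsion potential is substituted, the second derivatives agree by their symmetry. Of
    the quadratic contractions below, [P] and [Q] are the inverse-metric terms of the Ricci form,
    while [V] arises once from each product on the left, with opposite signs, and cancels. *)
Lemma ricci20_trace (b1 : 'I_n -> 'M[K]_n) (b2 : 'I_n -> 'I_n -> 'M[K]_n) a c :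
  (forall j a c,
    b1 j a c = - I * (G1 (hol n a) c j - G1 (hol n c) a j)) ->
  (forall i j a c, b2 i j a c =
    - I * (G2 (hol n i) (hol n a) c j - G2 (hol n i) (hol n c) a j)) ->
  contract2 (fun i j => (- b2 i j + G1 (hol n i) *m h *m b1 j
                         + b1 j *m h^T *m (G1 (hol n i))^T) a c) =
  I * \sum_k (\sum_d (G2 (hol n a) (hol n k) c d * h d k
                      + G1 (hol n k) c d * dh (hol n a) d k)
             - \sum_d (G2 (hol n c) (hol n k) a d * h d k
                      + G1 (hol n k) a d * dh (hol n c) d k)).
Proof.
move=> b1E b2E.
rewrite (eq_contract2 (F' := fun i j => (-1 * b2 i j a c
  + (G1 (hol n i) *m h *m b1 j) a c)
  + (b1 j *m h^T *m (G1 (hol n i))^T) a c)); last first.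
  by move=> i j; rewrite 3!mxE mulN1r.
rewrite 2!contract2D contract2Z contract2_mulmx.
rewrite (contract2_mulmxT (fun i _ => (G1 (hol n i))^T) (fun _ j => b1 j)).
rewrite sumrB; under eq_bigr do rewrite big_split /=.
rewrite big_split /= contract_dinv.
under [X in _ - X]eq_bigr do rewrite big_split /=.
rewrite [X in _ - X]big_split /= contract_dinv.
have S2E (x : 'I_(n + n)) (v : 'I_n) :
    \sum_i \sum_d G2 x (hol n i) v d * h d i =
    contract2 (fun i j => G2 x (hol n i) v j).
  by do 2!apply: eq_bigr => ? _; rewrite mulrC.
rewrite !S2E //.
have -> : contract2 (fun i j => b2 i j a c) =
   - I * (contract2 (fun i j => G2 (hol n a) (hol n i) c j)
   + -1 * contract2 (fun i j => G2 (hol n c) (hol n i) a j)).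
  rewrite -contract2Z -contract2D -contract2Z; apply: eq_contract2 => i j.
  by rewrite b2E !(G2C (hol n i)); ring.
set P := contract4 (fun i j m l => G1 (hol n i) c l * _).
set Q := contract4 (fun i j m l => G1 (hol n i) a l * G1 (hol n c) m j).
set V := contract4 (fun i j m l => G1 (hol n i) a l * G1 (hol n m) c j).
have -> : contract4 (fun i j m l => G1 (hol n i) a l * b1 j m c)
    = - I * (V + -1 * Q).
  rewrite -contract4Z -contract4D -contract4Z; apply: eq_contract4 => i j m l.
  by rewrite b1E; ring.
have -> : contract4 (fun i j m l => b1 j a m * (G1 (hol n i))^T l c)
    = - I * (P + -1 * V).
  rewrite [V]contract4_swap -contract4Z -contract4D -contract4Z.
  by apply: eq_contract4 => i j m l; rewrite b1E mxE; ring.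
by ring.
Qed.

(** The product of the two torsions expands into four contractions. One cancels [P], the quadratic
    term of the Chern curvature of g; the other three are the inverse-metric terms of the Ricci
    form. *)
Lemma ricci11_trace (b1 b1' : 'I_n -> 'M[K]_n) a b :
  I * I = -1 ->
  (forall j a c,
    b1 j a c = - I * (G1 (hol n a) c j - G1 (hol n c) a j)) ->
  (forall i d b,
    b1' i d b = I * (G1 (ahol n b) i d - G1 (ahol n d) i b)) ->
  (forall i j,
    G2 (hol n a) (ahol n b) i j - G2 (hol n a) (ahol n j) i b
    - G2 (hol n i) (ahol n b) a j + G2 (hol n i) (ahol n j) a b = 0) ->
  contract2 (fun i j => (- G2 (hol n i) (ahol n j)
     + G1 (hol n i) *m h *m G1 (ahol n j) - b1 j *m h^T *m b1' i) a b) =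
  \sum_k (\sum_d
      ((G2 (hol n a) (ahol n b) k d - G2 (hol n a) (ahol n d) k b) * h d k
       + (G1 (ahol n b) k d - G1 (ahol n d) k b) * dh (hol n a) d k)
    - \sum_d (G2 (ahol n b) (hol n k) a d * h d k
              + G1 (hol n k) a d * dh (ahol n b) d k)).
Proof.
move=> II b1E b1E' pc.
rewrite (eq_contract2 (F' := fun i j => (-1 * G2 (hol n i) (ahol n j) a b
  + (G1 (hol n i) *m h *m G1 (ahol n j)) a b)
  + -1 * (b1 j *m h^T *m b1' i) a b)); last first.
  have addE (X Y : 'M[K]_n) : (X + Y) a b = X a b + Y a b by rewrite mxE.
  have oppE (X : 'M[K]_n) : (- X) a b = - X a b by rewrite mxE.
  by move=> i j; rewrite !(addE, oppE) !mulN1r.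
rewrite 2!contract2D !contract2Z contract2_mulmx.
rewrite (contract2_mulmxT (fun i _ => b1' i) (fun _ j => b1 j)).
rewrite sumrB; under eq_bigr do rewrite big_split /=.
rewrite big_split /=.
rewrite (contract_dinv (fun k d => G1 (ahol n b) k d - G1 (ahol n d) k b)).
under [X in _ - X]eq_bigr do rewrite big_split /=.
rewrite [X in _ - X]big_split /= contract_dinv.
have -> : \sum_k \sum_d G2 (ahol n b) (hol n k) a d * h d k =
    contract2 (fun i j => G2 (ahol n b) (hol n i) a j).
  by do 2!apply: eq_bigr => ? _; rewrite mulrC.
(* The pluriclosed condition trades the second derivatives along a for those along the summed index.
   The first resulting term cancels the second derivatives of the other half of the Ricci form, and
   the last one is the second-order term on the left. *)
have -> : \sum_k \sum_d
    (G2 (hol n a) (ahol n b) k d - G2 (hol n a) (ahol n d) k b) * h d k =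
    contract2 (fun i j => G2 (ahol n b) (hol n i) a j) +
    -1 * contract2 (fun i j => G2 (hol n i) (ahol n j) a b).
  rewrite -contract2Z -contract2D.
  apply: eq_bigr => i _; apply: eq_bigr => j _; rewrite mulrC; congr (_ * _).
  apply/eqP; rewrite (G2C (ahol n b)) -subr_eq0 -(pc i j); apply/eqP.
  by ring.
set P := contract4 (fun i j m l => G1 (hol n i) a l * G1 (ahol n j) m b).
set Q := contract4 (fun i j m l => G1 (hol n i) a l * G1 (ahol n b) m j).
have -> : contract4 (fun i j m l => b1 j a m * b1' i l b) =
    contract4 (fun i j m l =>
      (G1 (ahol n b) i l - G1 (ahol n l) i b) * G1 (hol n a) m j)
    + -1 * (Q + -1 * P).
  rewrite [Q]contract4_swap [P]contract4_swap -contract4Z -contract4D -contract4Z.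
  rewrite -contract4D; apply: eq_contract4 => i j m l.
  rewrite b1E b1E'.
  (* The constants of a torsion and of its conjugate multiply to 1. *)
  have E (x y : K) : - I * x * (I * y) = x * y.
    by rewrite mulrACA mulNr II opprK mul1r.
  by rewrite E; ring.
by ring.
Qed.
End TraceIdentities.

(** * The curvature trace *)

Section MatrixContraction.
Variables (K : fieldType) (n : nat) (h : 'M[K]_n).

Definition mcontract m k (F : 'I_n -> 'I_n -> 'M[K]_(m, k)) :=
  \sum_i \sum_j h j i *: F i j.

Lemma mcontractE m k (F : 'I_n -> 'I_n -> 'M[K]_(m, k)) a b :
  mcontract F a b = contract2 h (fun i j => F i j a b).
Proof.
rewrite summxE; apply: eq_bigr => i _; rewrite summxE.
by apply: eq_bigr => j _; rewrite mxE.
Qed.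

Lemma mcontractMl m k l (A : 'M[K]_(l, m)) (F : 'I_n -> 'I_n -> 'M[K]_(m, k)) :
  mcontract (fun i j => A *m F i j) = A *m mcontract F.
Proof.
rewrite mulmx_sumr; apply: eq_bigr => i _; rewrite mulmx_sumr.
by apply: eq_bigr => j _; rewrite scalemxAr.
Qed.

Lemma mcontractMr m k l (A : 'M[K]_(k, l)) (F : 'I_n -> 'I_n -> 'M[K]_(m, k)) :
  mcontract (fun i j => F i j *m A) = mcontract F *m A.
Proof.
rewrite mulmx_suml; apply: eq_bigr => i _; rewrite mulmx_suml.
by apply: eq_bigr => j _; rewrite scalemxAl.
Qed.

Lemma mcontract_block m1 m2 k1 k2 (F11 : 'I_n -> 'I_n -> 'M[K]_(m1, k1))
    (F12 : 'I_n -> 'I_n -> 'M[K]_(m1, k2)) (F21 : 'I_n -> 'I_n -> 'M[K]_(m2, k1))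
    (F22 : 'I_n -> 'I_n -> 'M[K]_(m2, k2)) :
  mcontract (fun i j => block_mx (F11 i j) (F12 i j) (F21 i j) (F22 i j)) =
  block_mx (mcontract F11) (mcontract F12) (mcontract F21) (mcontract F22).
Proof.
apply/matrixP => a b; case: (split_ordP a) => i ->; case: (split_ordP b) => j ->;
  rewrite ?block_mxEul ?block_mxEur ?block_mxEdl ?block_mxEdr !mcontractE;
  apply: eq_contract2 => k l;
  by rewrite ?block_mxEul ?block_mxEur ?block_mxEdl ?block_mxEdr.
Qed.

Lemma eq_mcontract m k (F G : 'I_n -> 'I_n -> 'M[K]_(m, k)) :
  (forall i j, F i j = G i j) -> mcontract F = mcontract G.
Proof. by move=> E; do 2!apply: eq_bigr => ? _; rewrite E. Qed.

Lemma mcontract_trN m k (F : 'I_n -> 'I_n -> 'M[K]_(m, k)) :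
  mcontract (fun i j => - (F i j)^T) = - (mcontract F)^T.
Proof.
apply/matrixP => a b; rewrite mcontractE 2!mxE mcontractE -mulN1r -contract2Z.
by apply: eq_contract2 => i j; rewrite 2!mxE mulN1r.
Qed.

End MatrixContraction.

(** Conjugation turns the holomorphic index i into an antiholomorphic one and conversely, hence the
    exchanged arguments of [F]. *)
Lemma mcontract_adj (R : realType) n (h : 'M[R[i]]_n) m k
    (F : 'I_n -> 'I_n -> 'M[R[i]]_(m, k)) : adj h = h ->
  mcontract h (fun i j => adj (F j i)) = adj (mcontract h F).
Proof.
move=> hh; rewrite adj_sum /mcontract exchange_big; apply: eq_bigr => i _.
rewrite adj_sum; apply: eq_bigr => j _; rewrite adjZ -[in LHS]hh.
by rewrite mxE.
Qed.

Lemma tdel4 n (A B C D : 'I_(n + n)) :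
  [/\ tdel [tuple A; B; C; D] ord0 = [tuple B; C; D],
      tdel [tuple A; B; C; D] (lift ord0 ord0) = [tuple A; C; D],
      tdel [tuple A; B; C; D] (lift ord0 (lift ord0 ord0)) = [tuple A; B; D] &
      tdel [tuple A; B; C; D] (lift ord0 (lift ord0 (lift ord0 ord0))) =
      [tuple A; B; C]].
Proof.
by split; apply: eq_from_tnth => -[[|[|[|//]]] i];
  rewrite tnth_mktuple !(tnth_nth A).
Qed.

Lemma del_3form (R : realType) n (a : Defs.form R n 3) A B C D p :
  del a [tuple A; B; C; D] p =
  (if is_hol A then wderiv A (a [tuple B; C; D]) p else 0)
  - (if is_hol B then wderiv B (a [tuple A; C; D]) p else 0)
  + (if is_hol C then wderiv C (a [tuple A; B; D]) p else 0)
  - (if is_hol D then wderiv D (a [tuple A; B; C]) p else 0).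
Proof.
rewrite /del big_mkcond !big_ord_recl big_ord0 /=.
have [-> -> -> ->] := tdel4 A B C D.
rewrite !(tnth_nth A) /=.
move: (wderiv A _ _) (wderiv B _ _) (wderiv C _ _) (wderiv D _ _) => x y z t.
by case: (is_hol A); case: (is_hol B); case: (is_hol C); case: (is_hol D); ring.
Qed.

Lemma adj_core (R : realType) n (B2 G H B : 'M[R[i]]_n) :
  adj (- B2 + G *m H *m B + B *m H^T *m G^T) =
  - adj B2 + adj B *m adj H *m adj G + (adj G)^T *m (adj H)^T *m adj B.
Proof. by rewrite 2!adjD adjN 4!adjM 2!adj_tr !mulmxA. Qed.

(** Transposition reverses the product of B and C, and their two antisymmetry signs cancel. *)
Lemma trN_core (K : fieldType) n (G2 X Y H B C : 'M[K]_n) :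
  B^T = - B -> C^T = - C ->
  - (- G2 + X *m H *m Y - B *m H^T *m C)^T =
  G2^T - Y^T *m H^T *m X^T + C *m H *m B.
Proof.
move=> BT CT; have trD (A A' : 'M[K]_n) : (A + A')^T = A^T + A'^T by exact: raddfD.
have trN (A : 'M[K]_n) : (- A)^T = - A^T by exact: raddfN.
rewrite !trD !trN 4!trmx_mul trmxK BT CT !mulmxA !opprD !opprK.
by rewrite mulmxN mulNmx mulNmx opprK.
Qed.

(** * The curvature trace in terms of the Bismut-Ricci form *)

Section LocalFlow.
Variables (R : realType) (n : nat) (U : set (cspace R n)) (oU : open U).
Variables (g b : Defs.mfun R n).
Hypothesis gs : forall i j, csmooth U (fun q => g q i j).
Hypothesis bs : forall i j, csmooth U (fun q => b q i j).
Hypothesis gu : forall q, U q -> g q \in unitmx.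
Hypothesis gherm : forall q, U q -> adj (g q) = g q.
Hypothesis banti : forall q, U q -> (b q)^T = - b q.
Hypothesis tors : torsion_potential g b U.
Hypothesis pc : pluriclosed g U.

Let h q := invmx (g q).

Lemma adj_wderiv_mx_metric A p : U p ->
  adj (wderiv_mx A g p) = wderiv_mx (conj_idx A) g p.
Proof.
move=> Up; apply/esym/wderiv_mx_eq.
apply: mder_germ (mder_adj_wirtinger (smooth_mder A gs Up)); last by rewrite gherm.
exact: near_open oU _ _ Up gherm.
Qed.

Lemma tr_wderiv_mx_torsion A p : U p -> (wderiv_mx A b p)^T = - wderiv_mx A b p.
Proof.
move=> Up; rewrite -[LHS](wderiv_mx_eq (mder_tr (smooth_mder A bs Up))).
apply/wderiv_mx_eq; apply: mder_germ (mderN (smooth_mder A bs Up)).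
  have E q : U q -> - b q = (b q)^T by move=> Uq; rewrite banti.
  exact: near_open oU _ _ Up E.
by rewrite banti.
Qed.

Lemma form20E i j : form20 b [tuple hol n i; hol n j] = fun q => b q i j.
Proof.
by apply/funext => q; rewrite /form20 !(tnth_nth (hol n i)) block_mxEul.
Qed.

(** The torsion potential on the triple (a, c, jbar): delbar differentiates along jbar only, del
    along a and c only. *)
Lemma wderiv_mx_torsion j a c q : U q ->
  wderiv_mx (ahol n j) b q a c =
  - 'i * (wderiv_mx (hol n a) g q c j - wderiv_mx (hol n c) g q a j).
Proof.
move=> Uq; have := tors [tuple hol n a; hol n c; ahol n j] Uq.
rewrite delbar_2form del_2form !is_hol_hol is_hol_ahol /= subrr add0r addr0.
rewrite form20E !(wderiv_kahler gs) // !riem_wderiv_ha /jsign !is_hol_hol => E.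
by rewrite mxE E -mulrBr mulNr.
Qed.

Lemma wderiv_mx2_torsion i j a c p : U p ->
  wderiv_mx (hol n i) (wderiv_mx (ahol n j) b) p a c =
  - 'i * (wderiv_mx (hol n i) (wderiv_mx (hol n a) g) p c j
          - wderiv_mx (hol n i) (wderiv_mx (hol n c) g) p a j).
Proof.
move=> Up; rewrite [LHS]mxE; apply: wderiv_eq.
have H := derMl (- 'i) (derB (smooth_mder2 (hol n i) (hol n a) gs Up c j)
  (smooth_mder2 (hol n i) (hol n c) gs Up a j)).
apply: der_germ H; last by rewrite wderiv_mx_torsion.
have E q : U q -> - 'i * (wderiv_mx (hol n a) g q c j - wderiv_mx (hol n c) g q a j) =
  wderiv_mx (ahol n j) b q a c by move=> Uq; rewrite wderiv_mx_torsion.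
exact: near_open oU _ _ Up E.
Qed.

Lemma delbar_kahler i a j q : U q ->
  delbar (kahler_form g) [tuple hol n i; ahol n a; ahol n j] q =
  'i * (wderiv_mx (ahol n j) g q i a - wderiv_mx (ahol n a) g q i j).
Proof.
move=> Uq; rewrite delbar_2form is_hol_hol !is_hol_ahol /= add0r.
rewrite !(wderiv_kahler gs) // !riem_wderiv_ha /jsign is_hol_hol.
by rewrite mulrBr addrC.
Qed.

Lemma wderiv_delbar_kahler A i a j p : U p ->
  wderiv A (delbar (kahler_form g) [tuple hol n i; ahol n a; ahol n j]) p =
  'i * (wderiv_mx A (wderiv_mx (ahol n j) g) p i a
        - wderiv_mx A (wderiv_mx (ahol n a) g) p i j).
Proof.
move=> Up; apply: wderiv_eq.
have H := derMl 'i (derB (smooth_mder2 A (ahol n j) gs Up i a)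
  (smooth_mder2 A (ahol n a) gs Up i j)).
apply: der_germ H; last by rewrite delbar_kahler.
have E q : U q -> 'i * (wderiv_mx (ahol n j) g q i a - wderiv_mx (ahol n a) g q i j) =
  delbar (kahler_form g) [tuple hol n i; ahol n a; ahol n j] q.
  by move=> Uq; rewrite delbar_kahler.
exact: near_open oU _ _ Up E.
Qed.

Lemma pluriclosedE a i c j p : U p ->
  wderiv_mx (hol n a) (wderiv_mx (ahol n c) g) p i j
  - wderiv_mx (hol n a) (wderiv_mx (ahol n j) g) p i c
  - wderiv_mx (hol n i) (wderiv_mx (ahol n c) g) p a j
  + wderiv_mx (hol n i) (wderiv_mx (ahol n j) g) p a c = 0.
Proof.
move=> Up; have := pc [tuple hol n a; hol n i; ahol n c; ahol n j] Up.
rewrite del_3form (is_hol_hol a) (is_hol_hol i) (is_hol_ahol c) (is_hol_ahol j).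
rewrite subr0 addr0.
rewrite !wderiv_delbar_kahler // -mulrBr mulrA sqr_imaginary mulN1r => /eqP.
by rewrite oppr_eq0 => /eqP E; rewrite -[RHS]oppr0 -[in RHS]E; ring.
Qed.

Definition ricci11 p : 'M[R[i]]_n :=
  \matrix_(i, j) bismut_ricci g [tuple hol n i; ahol n j] p.
Definition ricci20 p : 'M[R[i]]_n :=
  \matrix_(i, j) bismut_ricci g [tuple hol n i; hol n j] p.

Section AtPoint.
Variables (p : cspace R n) (Up : U p).

(** The upper left block of [chern_gen_metric]; [core12] is the upper right one without its right
    factor. The two lower blocks are expressed through these. *)
Let core11 i j := - wderiv_mx (hol n i) (wderiv_mx (ahol n j) g) p
  + wderiv_mx (hol n i) g p *m h p *m wderiv_mx (ahol n j) g p
  - wderiv_mx (ahol n j) b p *m (h p)^T *m adj (wderiv_mx (ahol n i) b p).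

Let core12 i j := - wderiv_mx (hol n i) (wderiv_mx (ahol n j) b) p
  + wderiv_mx (hol n i) g p *m h p *m wderiv_mx (ahol n j) b p
  + wderiv_mx (ahol n j) b p *m (h p)^T *m (wderiv_mx (hol n i) g p)^T.

Lemma trace_core12 : mcontract (h p) core12 = ricci20 p.
Proof.
apply/matrixP => a c; rewrite mcontractE mxE (bismut_ricciE gs gu) //.
under [in RHS]eq_bigr do rewrite !(wderiv_bismut_hh oU gs gu) //.
apply: (@ricci20_trace _ _ (h p) 'i (fun A => wderiv_mx A g p)
  (fun A B => wderiv_mx A (wderiv_mx B g) p)).
- by move=> A B; exact: (wderiv_mxC oU A B gs Up).
- by move=> j a' c'; exact: wderiv_mx_torsion.
- by move=> i j a' c'; exact: wderiv_mx2_torsion.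
Qed.

(** The factor i is that of omega = i g: the flow of omega reads g' = i rho on components, which is
    minus this trace. *)
Lemma trace_core11 : mcontract (h p) core11 = - ('i *: ricci11 p).
Proof.
apply/matrixP => a c; rewrite mcontractE !mxE (bismut_ricciE gs gu) //.
rewrite mulrA sqr_imaginary mulN1r opprK.
under [in RHS]eq_bigr do rewrite (wderiv_bismut_ah oU gs gu) //
  (wderiv_bismut_hh oU gs gu) //.
apply: (@ricci11_trace _ _ (h p) 'i (fun A => wderiv_mx A g p)
  (fun A B => wderiv_mx A (wderiv_mx B g) p) _ (fun j => wderiv_mx (ahol n j) b p)
  (fun i => adj (wderiv_mx (ahol n i) b p))).
- by move=> A B; exact: (wderiv_mxC oU A B gs Up).
- exact: sqr_imaginary.
- by move=> j a' c'; exact: wderiv_mx_torsion.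
- move=> i d e; rewrite mxE wderiv_mx_torsion //.
  have -> : (- 'i * (wderiv_mx (hol n e) g p d i - wderiv_mx (hol n d) g p e i))^*%C =
    (- 'i)^*%C * ((wderiv_mx (hol n e) g p d i)^*%C - (wderiv_mx (hol n d) g p e i)^*%C).
    by rewrite rmorphM rmorphB.
  have -> : (- 'i : R[i])^*%C = 'i.
    by apply/eqP; rewrite eq_complex /= oppr0 opprK !eqxx.
  congr (_ * (_ - _)).
    have /matrixP/(_ i d) := adj_wderiv_mx_metric (hol n e) Up.
    by rewrite mxE conj_idx_hol.
  have /matrixP/(_ i e) := adj_wderiv_mx_metric (hol n d) Up.
  by rewrite mxE conj_idx_hol.
- by move=> i j; exact: pluriclosedE.
Qed.

Lemma curv_trace_gen_metric :
  \matrix_(A, B) curv_trace g (gen_metric g b) A B p =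
  ugauge (b p) *m block_mx
    (- ('i *: ricci11 p)) (ricci20 p *m (h p)^T)
    ((h p)^T *m adj (ricci20 p)) ((h p)^T *m ('i *: ricci11 p)^T *m (h p)^T)
  *m lgauge (adj (b p)).
Proof.
have hh : adj (h p) = h p by rewrite /h adjV gherm.
transitivity (mcontract (h p)
    (fun i j => \matrix_(A, B) chern_curv (gen_metric g b) i j A B p)).
  apply/matrixP => A B; rewrite mxE mcontractE.
  by do 2!apply: eq_bigr => ? _; rewrite mxE.
pose k := (h p)^T.
pose W21 i j := - adj (wderiv_mx (ahol n i) (wderiv_mx (hol n j) b) p)
  + adj (wderiv_mx (ahol n i) b p) *m h p *m wderiv_mx (ahol n j) g p
  + (wderiv_mx (ahol n j) g p)^T *m k *m adj (wderiv_mx (ahol n i) b p).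
pose W22 i j := (wderiv_mx (hol n i) (wderiv_mx (ahol n j) g) p)^T
  - (wderiv_mx (ahol n j) g p)^T *m k *m (wderiv_mx (hol n i) g p)^T
  + adj (wderiv_mx (ahol n i) b p) *m h p *m wderiv_mx (ahol n j) b p.
rewrite (@eq_mcontract _ _ _ _ _ _ (fun i j => ugauge (b p) *m
  block_mx (core11 i j) (core12 i j *m k) (k *m W21 i j) (k *m W22 i j *m k)
  *m lgauge (adj (b p)))); last first.
  by move=> i j; rewrite (chern_gen_metric oU gs bs gu).
rewrite mcontractMr mcontractMl mcontract_block.
have adj_core12 i j : W21 i j = adj (core12 j i).
  rewrite /core12 adj_core hh (adj_wderiv_mx_metric (hol n j) Up) conj_idx_hol.
  by rewrite (wderiv_mxC oU (hol n j) (ahol n i) bs Up).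
have tr_core11 i j : W22 i j = - (core11 i j)^T.
  apply/esym/trN_core; first exact: tr_wderiv_mx_torsion.
  by rewrite -adj_tr (tr_wderiv_mx_torsion _ Up) adjN.
have trNN (X : 'M[R[i]]_n) : - (- X)^T = X^T.
  by rewrite raddfN /= opprK.
apply/gauge_congr/block_mx_congr.
- exact: trace_core11.
- by rewrite mcontractMr trace_core12.
- rewrite mcontractMl (eq_mcontract _ adj_core12) (mcontract_adj _ hh).
  by rewrite trace_core12.
- rewrite mcontractMr mcontractMl (eq_mcontract _ tr_core11) mcontract_trN.
  by rewrite trace_core11 trNN.
Qed.

End AtPoint.
End LocalFlow.

Lemma herm_posdef_unitmx (R : realType) n (A : 'M[R[i]]_n) :
  herm_posdef A -> A \in unitmx.
Proof.
case=> _ Apos; rewrite unitmxE unitfE; apply/det0P => -[v v0 vA].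
by have := Apos v v0; rewrite vA mul0mx mxE ltxx.
Qed.

Theorem proposition3p2 (R : realType) (n : nat) (M : complex_manifold R n)
    (T : interval R) (hT : exists s t : R, [/\ s \in T, t \in T & s < t])
    (g b : R -> components M) (sol : pluriclosed_flow T g b)
    (t : R) (ht : t \in T) (c : chart M) (p : cspace R n) (hp : chart_im c p)
    (A B : 'I_(n + n)) :
  deriv_in T (fun s => gen_metric (g s c) (b s c) p A B) t
    (- curv_trace (g t c) (gen_metric (g t c) (b t c)) A B p).
Proof.
have gpos s : s \in T -> herm_posdef (g s c p).
  by move=> /sol[[_ gpos _] _ _ _ _]; exact: gpos.
have [[gs gherm _] [bs banti _] pc tors flow] := sol t ht.
pose D := complexify (interval_derivation T t).
have Dg : mder D (fun s => g s c p) ('i *: ricci11 (g t c) p).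
  move=> i j; have [Dij _] := flow c [tuple hol n i; ahol n j] p hp.
  have {}Dij : D (fun s => kahler_form (g s c) [tuple hol n i; ahol n j] p)
    (- bismut_ricci (g t c) [tuple hol n i; ahol n j] p).
    by move: Dij; rewrite /form_part /= is_hol_hol is_hol_ahol.
  (* Since omega has components i g, multiplication by -i recovers g. *)
  apply: der_eq (derMl (- 'i) Dij) _ _ => [s|].
    rewrite kahler_formE riem_ha /jsign is_hol_hol mulrA mulNr sqr_imaginary.
    by rewrite opprK mul1r.
  by rewrite 2!mxE mulrNN.
have Db : mder D (fun s => b s c p) (- ricci20 (g t c) p).
  move=> i j; have [_ Dij] := flow c [tuple hol n i; hol n j] p hp.
  have {}Dij : D (fun s => form20 (b s c) [tuple hol n i; hol n j] p)
    (- bismut_ricci (g t c) [tuple hol n i; hol n j] p).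
    by move: Dij; rewrite /form_part /= !is_hol_hol.
  by apply: der_eq Dij _ _ => [s|]; rewrite ?form20E ?mxE.
have gu s : s \in T -> g s c p \in unitmx.
  by move=> /gpos; exact: herm_posdef_unitmx.
have nu : germ D [set s | g s c p \in unitmx].
  by apply: nearW => s; exact: gu.
have Dk := mder_tr (mderV nu (gu t ht) Dg).
have DG := mder_gauge Db (adj_mder_time Db) Dg (mder_cst D 0) (mder_cst D 0) Dk.
(* The goal [deriv_in] unfolds to this derivation, to which the calculus applies. *)
suff : D (fun s => gen_metric (g s c) (b s c) p A B)
  (- curv_trace (g t c) (gen_metric (g t c) (b t c)) A B p) by [].
apply: der_eq (DG A B) _ _ => [s|]; first by rewrite gen_metricE.
have cu q : chart_im c q -> g t c q \in unitmx.
  by move=> /gherm; exact: herm_posdef_unitmx.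
have ch q : chart_im c q -> adj (g t c q) = g t c q by move=> /gherm[].
have /matrixP/(_ A B) := curv_trace_gen_metric (@im_open _ _ M c) (gs c) (bs c) cu ch
  (banti c) (tors c) (pc c) hp.
have negE (X Y : 'M[R[i]]_(n + n)) x : Y = - X -> x = X A B -> Y A B = - x.
  by move=> -> ->; rewrite mxE.
rewrite mxE => E; apply: negE E.
rewrite -[in RHS]mulNmx -[in RHS]mulmxN opp_block_mx; apply: gauge_congr.
rewrite !(mul0mx, mulmx0, addr0, add0r) opprK adjN mulNmx mulmxN.
by rewrite raddfN /= 2!trmx_mul mulmxA.
Qed.
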